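(* Fix an integer $b \geq 2$, let $C(b)=\{0,1,\ldots,b-1\}$, and fix $A\subset C(b)$ with $k \coloneqq \#(A)\geq 2$. Let $F$ be the set of all numbers $x\in[0,1]$ that can be written as $x=\sum_{i=1}^{\infty}\omega_i b^{-i}$ with $\omega_i\in A$ for every $i\in\mathbb{N}$, and let $\delta$ be the Hausdorff dimension of $F$ (so $\delta=\log(k)/\log(b)$). Let $S$ be the set of all elements of $F$ that have at least one base $b$ expansion $\omega=\omega_1\omega_2\cdots\in A^{\mathbb{N}}$ which is uniformly de Bruijn. Then \[ 0 < \alpha_k \delta \leq \dim_H(S) \leq \frac{\log (k!)}{k\log (k)}\, \delta < \delta, \] where \[ \alpha_k = \begin{cases} 1/49 & k = 2,\\ (8\cdot (9\log_4(3) - 1))^{-1} & k = 3,\\ \frac{\log((k - 2)!)}{k\log(k)} & k \geq 4. \end{cases} \] In particular, $S$ has positive but not full Hausdorff dimension.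
   Context: Let $A$ be a finite alphabet with $\#(A)=k\geq 2$. A (non-cyclic) de Bruijn sequence of order $n$ in $A$ is a finite sequence of length $k^n+n-1$ in $A$ in which every sequence of length $n$ in $A$ appears as a consecutive substring exactly once. For an infinite sequence $\omega\in A^{\mathbb{N}}$, let $B_\omega$ be the set of $n\in\mathbb{N}$ such that the initial segment of $\omega$ of length $k^n+n-1$ is a de Bruijn sequence of order $n$ in $A$. The sequence $\omega$ is uniformly de Bruijn if $B_\omega$ has bounded gap sizes, i.e. there is $L$ such that every block of $L$ consecutive positive integers contains an element of $B_\omega$. A base $b$ expansion of $x\in[0,1]$ is a sequence $(\omega_i)$ of digits in $\{0,\ldots,b-1\}$ with $x=\sum_i \omega_i b^{-i}$. $\dim_H$ denotes Hausdorff dimension. *)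

(* Defs.v *)
From HB Require Import structures.
From mathcomp Require Import all_boot all_order all_algebra.
From mathcomp Require Import all_classical all_reals all_analysis.
Import Order.TTheory GRing.Theory Num.Theory.
Import numFieldNormedType.Exports.

Local Open Scope classical_set_scope.
Local Open Scope ring_scope.

(* The value on the empty set is -oo. *)
Definition diam {R : realType} {V : normedModType R} (U : set V) : \bar R :=
  ereal_sup [set z | exists x y, [/\ U x, U y & z = `|x - y|%:E]].

(* diam(U)^s, where the empty set has weight 0 for every s, including s = 0;
   for nonempty U, 0^0 = 1, so that the case s = 0 is the counting measure. *)
Definition diam_pow {R : realType} {V : normedModType R} (s : R) (U : set V)
    : \bar R :=
  if U == set0 then 0%E else poweR (diam U) s.

Definition hausdorff_premeasure {R : realType} {V : normedModType R}
    (s eps : R) (E : set V) : \bar R :=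
  ereal_inf [set (\sum_(i <oo) diam_pow s (U i))%E |
    U in [set U : nat -> set V | E `<=` \bigcup_i U i /\
                                 forall i, (diam (U i) <= eps%:E)%E]].

Definition hausdorff_measure {R : realType} {V : normedModType R}
    (s : R) (E : set V) : \bar R :=
  ereal_sup [set hausdorff_premeasure s eps E | eps in [set eps : R | 0 < eps]].

Definition hausdorff_dim {R : realType} {V : normedModType R} (E : set V)
    : \bar R :=
  ereal_inf [set s%:E | s in [set s : R | 0 <= s /\
                                          hausdorff_measure s E = 0%E]].

Definition de_bruijn_length (k n : nat) : nat := (k ^ n + n - 1)%N.

Definition de_bruijn {C : finType} (A : {set C}) (n : nat) (s : seq C) : Prop :=
  [/\ size s = de_bruijn_length #|A| n,
      {subset s <= A} &
      forall w : seq C, size w = n -> {subset w <= A} ->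
        exists! i : nat, (i + n <= size s)%N /\ take n (drop i s) = w].

(* Infinite words are indexed from 0: omega i is the letter of index i + 1. *)
Definition de_bruijn_orders {C : finType} (A : {set C}) (omega : nat -> C)
    : set nat :=
  [set n | (0 < n)%N /\
           de_bruijn A n (mkseq omega (de_bruijn_length #|A| n))].

Definition uniformly_de_bruijn {C : finType} (A : {set C}) (omega : nat -> C)
    : Prop :=
  exists L : nat, forall m : nat, (0 < m)%N ->
    exists2 n : nat, (m <= n < m + L)%N & de_bruijn_orders A omega n.

Definition is_expansion {R : realType} {b : nat} (omega : nat -> 'I_b) (x : R)
    : Prop :=
  series (fun i => (omega i)%:R / b%:R ^+ i.+1 : R) @ \oo --> x.

Definition digit_set (R : realType) {b : nat} (A : {set 'I_b}) : set R :=
  [set x | 0 <= x <= 1 /\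
           exists2 omega : nat -> 'I_b,
             forall i, omega i \in A & is_expansion omega x].

Definition uniformly_de_bruijn_set (R : realType) {b : nat} (A : {set 'I_b})
    : set R :=
  [set x | digit_set R A x /\
           exists omega : nat -> 'I_b,
             [/\ forall i, omega i \in A, is_expansion omega x
               & uniformly_de_bruijn A omega]].

Definition alpha (R : realType) (k : nat) : R :=
  if k == 2%N then 1 / 49
  else if k == 3%N then (8 * (9 * (ln 3 / ln 4) - 1))^-1
  else ln ((k - 2)`!)%:R / (k%:R * ln k%:R).

(* Main.v *)
Require Import Defs.
From mathcomp Require Import all_boot all_order all_algebra.
From mathcomp Require Import all_classical all_reals all_analysis.
From mathcomp Require Import zify ring lra.
Import Order.TTheory GRing.Theory Num.Theory.
Import numFieldNormedType.Exports.
Local Open Scope ring_scope.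
Set Implicit Arguments.
Unset Strict Implicit.
Unset Printing Implicit Defensive.

(* Upper bounds: in a de Bruijn word of order n every word of length n - 1 is
   followed once by each letter, so the word is determined by its first n - 1
   letters and one permutation of A for each word of length n - 1; covering S by
   the corresponding cylinders gives the factor log (k!) / (k log k).

   Lower bounds: de Bruijn words of order 3i are extended to order 3(i + 1) by
   random Eulerian tours of the de Bruijn graph on words of length 3i + 2, from
   which the edges already used are removed. A de Bruijn word of order 3i uses
   at most one edge of each complete bipartite block of this graph, so a tree
   leading to the starting vertex exists, and a walk that keeps the tree edge of
   each vertex for its last exit cannot get stuck before using every edge. The
   other exits are chosen freely. For k = 2 this leaves no choice; but of the two
   words cy, dy preceding an unvisited y both may be given the same tree edge,
   which makes some ye a leaf of the tree, and the last exit of almost all these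
   leaves can be left free as well. The uniform choices give a mass on words
   decaying exponentially at all scales, which bounds the dimension from below. *)

(** * Walks in labelled graphs and Eulerian tours *)

(** Why orders grow by 3: a block is indexed by its middle word, one letter shorter than a vertex.
    If orders grew by 2, the middle words would have the old order [n] as length, and a de Bruijn
    word of order [n] already uses nearly all of them, so no leaf would be left for [k = 2]. With 3
    they have length [n + 1], and for [k = 2] about half of them are unvisited. No average over the
    random choices is taken. The number of letters offered at a step is bounded below by the number
    of exits of the current vertex used so far, so the product of these numbers is controlled along
    every admissible word. The worst word first visits the vertices without choice; the entropy per
    letter at that moment is [entropy_rate]. For [k >= 4] this gives exactly [alpha], for [k = 2, 3]
    slightly more. The mass is not turned into a measure: it is an additive function on finite
    words, and a branch escaping a countable family of cylinders of total mass below 1 is built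
    letter by letter. *)

Section Walks.
Variables (V B : finType) (step : V -> B -> V).
Implicit Types (v x : V) (u : seq B) (e : V * B).

Fixpoint trace v u : seq (V * B) :=
  if u is c :: u' then (v, c) :: trace (step v c) u' else [::].

Definition endpt v u := foldl step v u.

Definition target e := step e.1 e.2.

Lemma size_trace v u : size (trace v u) = size u.
Proof. by elim: u v => //= c u IH v; rewrite IH. Qed.

Lemma trace_cat v u1 u2 :
  trace v (u1 ++ u2) = trace v u1 ++ trace (endpt v u1) u2.
Proof. by elim: u1 v => //= c u1 IH v; rewrite IH. Qed.

Lemma trace_rcons v u c :
  trace v (rcons u c) = rcons (trace v u) (endpt v u, c).
Proof. by rewrite -cats1 trace_cat cats1. Qed.

Lemma trace_vertices v u :
  v :: map target (trace v u) = rcons (map fst (trace v u)) (endpt v u).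
Proof. by elim: u v => //= c u IH v; rewrite IH. Qed.

Lemma trace_balance v u (P : pred V) :
  (P v + count P (map target (trace v u)) =
   count P (map fst (trace v u)) + P (endpt v u))%N.
Proof.
have := congr1 (count P) (trace_vertices v u).
by rewrite -cats1 count_cat /= addn0.
Qed.

Definition exits v u x := [seq e.2 | e <- trace v u & e.1 == x].

(** The walk can be replayed: its next letter is always the head of the remaining exit list of the
    current vertex. *)
Lemma exits_inj v u u' : size u = size u' -> exits v u =1 exits v u' -> u = u'.
Proof.
elim: u u' v => [|c u IH] [|c' u'] v //= [szu] eq_ex.
have := eq_ex v; rewrite /exits /= eqxx /= => -[cc' _]; rewrite -{}cc' in eq_ex *.
congr cons; apply: (IH _ (step v c)) => // x.
by have := eq_ex x; rewrite /exits /=; case: ifP => //= _ [].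
Qed.

Lemma size_exits v u x : size (exits v u x) = count_mem x (map fst (trace v u)).
Proof. by rewrite size_map size_filter count_map. Qed.

Lemma mem_exits v u x c : (c \in exits v u x) = ((x, c) \in trace v u).
Proof.
apply/mapP/idP => [[[y d]]|xcu].
  by rewrite mem_filter /= => /andP[/eqP -> ?] ->.
by exists (x, c) => //; rewrite mem_filter eqxx.
Qed.

Lemma uniq_exits v u x : uniq (trace v u) -> uniq (exits v u x).
Proof.
move=> uu; rewrite map_inj_in_uniq ?filter_uniq // => -[y c] [z d].
by rewrite !mem_filter /= => /andP[/eqP-> _] /andP[/eqP-> _] ->.
Qed.

Lemma uniq_trace_all v u : uniq (trace v u) -> size u = (#|V| * #|B|)%N ->
  forall e, e \in trace v u.
Proof.
move=> /card_uniqP uu su e.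
have : trace v u =i predT.
  by apply/subset_cardP; [rewrite uu size_trace su -card_prod | exact/subset_predT].
by move->.
Qed.

Lemma size_exits_uniq v u x : uniq (trace v u) -> (size (exits v u x) <= #|B|)%N.
Proof. by move=> /(uniq_exits x)/card_uniqP <-; exact: max_card. Qed.

Lemma exits_full v u x : uniq (trace v u) ->
  (forall c, (x, c) \in trace v u) <-> size (exits v u x) = #|B|.
Proof.
move=> uu; have /card_uniqP ue := uniq_exits x uu; split=> [h|h c].
  by rewrite -ue; apply: eq_card => c; rewrite mem_exits h.
rewrite -mem_exits; have : exits v u x =i predT; last by move->.
by apply/subset_cardP; [rewrite ue h | exact/subset_predT].
Qed.

Lemma count_trace_card v u (P : pred (V * B)) : uniq (trace v u) ->
  count P (trace v u) = #|[set e in trace v u | P e]|.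
Proof.
move=> uu; rewrite -size_filter -(card_uniqP (filter_uniq P uu)).
by apply: eq_card => e; rewrite !inE mem_filter andbC.
Qed.

End Walks.

Section ExitCount.
Variables (V B : finType) (step : V -> B -> V).

(* A word tracing every edge once is determined by its starting vertex and by
   the order in which it uses the exits of each vertex. *)
Lemma card_eulerian_walks (m : nat) :
  (#|[set p : V * m.-tuple B |
      uniq (trace step p.1 p.2) & m == #|V| * #|B|]| <=
   #|V| * (#|B|)`! ^ #|V|)%N.
Proof.
set S := [set p : _ | _ ].
pose T : {set (#|B|).-tuple B} := [set t : (#|B|).-tuple B | uniq t].
(* On [S] every exit list has length [#|B|], so the default of [insubd] never occurs. *)
pose code (p : V * m.-tuple B) : V * {ffun V -> (#|B|).-tuple B} :=
  (p.1, [ffun x => insubd [tuple of enum B] (exits step p.1 p.2 x)]).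
have sz p x : p \in S -> size (exits step p.1 p.2 x) = #|B|.
  rewrite inE => /andP[uu /eqP em].
  apply/(exits_full x uu) => c; apply: uniq_trace_all => //.
  by rewrite size_tuple.
have code_inj : {in S &, injective code}.
  move=> [v u] [v' u'] Su Su' [/= vv' /ffunP eqo]; rewrite -{}vv' in Su' eqo *.
  congr pair; apply/val_inj/(@exits_inj _ _ step v); first by rewrite !size_tuple.
  move=> x; have := congr1 val (eqo x).
  by rewrite !ffunE !val_insubd /= (sz _ x Su) (sz _ x Su') eqxx.
have -> : (#|V| * (#|B|)`! ^ #|V| =
    #|finset.setX (finset.setT : {set V})
       [set f : {ffun V -> (#|B|).-tuple B} | f \in ffun_on T]|)%N.
  rewrite cardsX cardsT cardsE card_ffun_on; congr (_ * _ ^ _)%N.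
  rewrite -ffactnn -(card_uniq_tuples #|B| predT).
  by apply: eq_card => t; rewrite !inE all_predT.
rewrite -(card_in_imset code_inj); apply/subset_leq_card/fintype.subsetP => q.
case/imsetP => p Sp ->; rewrite !inE /=; apply/ffun_onP => x; rewrite ffunE inE.
rewrite val_insubd (sz _ _ Sp) eqxx; apply: uniq_exits.
by move: Sp; rewrite inE => /andP[].
Qed.
End ExitCount.

(** * Tours that save the tree edge of each vertex for its last exit *)

Section EulerRule.
Variables (V B : finType) (step : V -> B -> V).
Hypothesis indegree :
  forall x, #|[set e : V * B | target step e == x]| = #|B|.
Variables (a : V) (u0 : seq B) (t : V -> B) (X : {set V}).
Local Notation trace := (trace step).
Local Notation endpt := (endpt step).
Local Notation exits := (exits step).

(* The Euler tour may leave a vertex through its tree edge [t] only when no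
   other exit is left, except at the vertices of [X], whose last exit is free;
   this says that for every such choice of last exits the root [a] is reached. *)
Definition trap_free := forall Z : {set V}, Z != finset.set0 -> a \notin Z ->
  exists2 p, p \in Z & if p \in X then [forall c, step p c \notin Z]
                       else step p (t p) \notin Z.

Definition avail u := [set c | (endpt a u, c) \notin trace a u].

Definition allowed u : {set B} :=
  if (endpt a u \in X) || (#|avail u| <= 1)%N then avail u
  else avail u :\ t (endpt a u).

Hypothesis tree_unused : forall p, p != a -> (p, t p) \notin trace a u0.
Hypothesis t_trap_free : trap_free.

Definition tour_invariant u := [/\ uniq (trace a u),
  {subset trace a u0 <= trace a u} &
  forall p, p != a -> p \notin X -> (p, t p) \in trace a u ->
    forall c, (p, c) \in trace a u].

Lemma allowed_sub u : {subset allowed u <= avail u}.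
Proof. by move=> c; rewrite /allowed; case: ifP => // _; rewrite in_setD1 => /andP[]. Qed.

Lemma tour_start : uniq (trace a u0) -> tour_invariant u0.
Proof. by move=> uu; split=> // p pa _ /negPn; rewrite tree_unused. Qed.

Lemma tour_step u c :
  tour_invariant u -> c \in allowed u -> tour_invariant (rcons u c).
Proof.
move=> [uu su iu] cu; have cav := allowed_sub cu.
split; rewrite trace_rcons.
- by rewrite rcons_uniq uu andbT; rewrite inE in cav.
- by move=> e eu; rewrite mem_rcons inE su ?orbT.
move=> p pa pX; rewrite !mem_rcons inE => /orP[/eqP[pe tpc] d|tpu d]; last first.
  by rewrite mem_rcons inE iu ?orbT.
rewrite mem_rcons inE pe; case: (boolP (_ \in trace a u)); first by rewrite orbT.
rewrite orbF => dav; move: cu; rewrite /allowed -pe (negPf pX) /=.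
case: ifP => [/card_le1P h cU|_]; last by rewrite in_setD1 -tpc eqxx.
by have := h _ cU d; rewrite !inE dav => /esym/eqP ->.
Qed.

Lemma size_exits_avail u : uniq (trace a u) ->
  (#|avail u| + size (exits a u (endpt a u)) = #|B|)%N.
Proof.
move=> /(uniq_exits (endpt a u))/card_uniqP <-.
have -> : #|exits a u (endpt a u)| = #|~: avail u|.
  by apply: eq_card => c; rewrite !inE negbK mem_exits.
by rewrite cardsC.
Qed.

Lemma entries_le u x : uniq (trace a u) ->
  (count_mem x (map (target step) (trace a u)) <= #|B|)%N.
Proof.
move=> uu; rewrite count_map count_trace_card // -(indegree x).
by apply/subset_leq_card/fintype.subsetP => e; rewrite !inE => /andP[].
Qed.

Lemma entries_full u x : uniq (trace a u) ->
  count_mem x (map (target step) (trace a u)) = #|B| ->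
  forall e, target step e = x -> e \in trace a u.
Proof.
move=> uu; rewrite count_map count_trace_card // -(indegree x) => h e ex.
have := subset_cardP h; rewrite (_ : _ \subset _); last first.
  by apply/fintype.subsetP => d; rewrite !inE => /andP[].
by move=> /(_ isT e); rewrite !inE ex eqxx andbT.
Qed.

Lemma tour_not_stuck u : tour_invariant u -> avail u = finset.set0 ->
  forall e, e \in trace a u.
Proof.
move=> [uu su iu] av0.
have bal (x : V) := trace_balance step a u (pred1 x).
have outE x := size_exits step a u x.
have zfull : size (exits a u (endpt a u)) = #|B|.
  by rewrite -(size_exits_avail uu) av0 cards0.
(* Otherwise the endpoint is entered once more than it is left, that is [#|B|.+1] times. *)
have za : endpt a u = a.
  apply/eqP; have := bal (endpt a u); rewrite -outE zfull /= eqxx eq_sym.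
  case: eqP => // _; rewrite add0n addn1 => h.
  by have := entries_le (endpt a u) uu; rewrite h ltnn.
have inout x : count_mem x (map (target step) (trace a u)) = size (exits a u x).
  by have := bal x; rewrite za outE addnC => /addIn.
have afull : size (exits a u a) = #|B| by rewrite -{2}za.
pose Z := [set x | size (exits a u x) != #|B|].
have full x : x \notin Z -> forall e, target step e = x -> e \in trace a u.
  by rewrite inE negbK => /eqP h; apply: entries_full => //; rewrite inout.
suff Z0 : Z = finset.set0.
  by move=> [x c]; apply: (full (step x c)) => //; rewrite Z0 inE.
apply/eqP/negPn/negP => Zn0.
have aZ : a \notin Z by rewrite inE afull eqxx.
have [p pZ hp] := t_trap_free Zn0 aZ.
have pa : p != a by apply: contraTneq pZ => ->; rewrite inE afull eqxx.
have npZ : ~ forall c, (p, c) \in trace a u.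
  by move=> /(exits_full _ uu) h; move: pZ; rewrite inE h eqxx.
apply: npZ; case: ifP hp => [pX /forallP h c|pX h]; first exact: full (h c) _ _.
by apply: iu; rewrite ?pX //; exact: full h _ _.
Qed.

Lemma allowed_neq0 u : tour_invariant u -> (size u < #|V| * #|B|)%N ->
  allowed u != finset.set0.
Proof.
move=> iu su; have av : avail u != finset.set0.
  apply: contraTneq su => /(tour_not_stuck iu) all_e.
  case: iu => /card_uniqP uu _ _; rewrite -leqNgt -(size_trace step a) -uu.
  by rewrite -card_prod; apply/subset_leq_card/fintype.subsetP => e _; exact: all_e.
rewrite /allowed; case: ifP => // /norP[_]; rewrite -ltnNge => av1.
rewrite -card_gt0; have := cardsD1 (t (endpt a u)) (avail u).
by case: (_ \in _); lia.
Qed.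

Lemma card_allowed_ge u : uniq (trace a u) ->
  let j := size (exits a u (endpt a u)) in
  ((if endpt a u \in X then #|B| - j else #|B|.-1 - j) <= #|allowed u|)%N.
Proof.
move=> /size_exits_avail <- /=; rewrite /allowed; case: ifP => _ /=.
  by rewrite addnK.
case: ifP => [h|_]; first by lia.
have := cardsD1 (t (endpt a u)) (avail u).
by case: (_ \in _); lia.
Qed.

End EulerRule.

(** The case [m = 0] rests on the convention [ln 0 = 0]; it occurs at the last, forced exit of a
    vertex. *)
Lemma le_ln_nat (R : realType) (m p : nat) : (m <= p)%N -> ln m%:R <= ln p%:R :> R.
Proof.
case: m => [|m] mp; last by rewrite ler_ln ?posrE ?ltr0n ?ler_nat //; lia.
by case: p mp => [|p] _ //; rewrite ln0 // ln_ge0 // ler1n.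
Qed.

(** * Entropy of a tour, counted vertex by vertex *)

Section TourEntropy.
Variables (R : realType) (V B : finType) (step : V -> B -> V).
Variables (a : V) (u0 : seq B) (t : V -> B) (X : {set V}).
Hypothesis tree_unused : forall p, p != a -> (p, t p) \notin trace step a u0.
Hypothesis start_uniq : uniq (trace step a u0).
Variables (omega : nat -> B) (n : nat).
Local Notation word i := (u0 ++ mkseq omega i).
Local Notation allowed := (allowed step a t X).
Local Notation outdeg u v := (size (exits step a u v)).
Hypothesis omega_allowed : forall i, (i < n)%N -> omega i \in allowed (word i).

Lemma tour_prefix i : (i <= n)%N -> tour_invariant step a u0 t X (word i).
Proof.
elim: i => [_|i IH lin]; first by rewrite cats0; exact: tour_start.
by rewrite mkseqS -rcons_cat; apply: tour_step (omega_allowed lin); exact/IH/ltnW.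
Qed.

Definition log_choices (free : bool) (j : nat) : R :=
  ln (if free then #|B| - j else #|B|.-1 - j)%N%:R.

Lemma exits_rcons u c v : exits step a (rcons u c) v =
  if endpt step a u == v then rcons (exits step a u v) c else exits step a u v.
Proof. by rewrite /exits trace_rcons filter_rcons /=; case: ifP; rewrite ?map_rcons. Qed.

(** A step leaving [z] with [j] exits of [z] used contributes at least [log_choices] at [j], and
    raises the exit count of [z] alone by one. The order in which vertices are visited therefore
    disappears from the bound. *)
Lemma tour_entropy_potential i : (i <= n)%N ->
  \sum_(v : V) \sum_(outdeg u0 v <= j < outdeg (word i) v) log_choices (v \in X) j
   <= \sum_(0 <= j < i) ln #|allowed (word j)|%:R.
Proof.
elim: i => [_|i IH lin].
  by rewrite big_geq // big1 // => v _; rewrite cats0 big_geq.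
rewrite big_nat_recr //= mkseqS -rcons_cat; set z := endpt step a (word i).
have [uu _ _] := tour_prefix (ltnW lin).
have mono v : (outdeg u0 v <= outdeg (word i) v)%N.
  by rewrite /exits trace_cat filter_cat map_cat size_cat leq_addr.
rewrite (bigD1 z) //= exits_rcons eqxx size_rcons big_nat_recr //=.
rewrite addrAC; apply: lerD.
  apply: le_trans (IH (ltnW lin)); rewrite [leRHS](bigD1 z) //=; apply: lerD => //.
  by apply: ler_sum => v vz; rewrite exits_rcons eq_sym (negPf vz).
by apply: le_ln_nat; exact: card_allowed_ge uu.
Qed.

Lemma sum_outdeg u : (\sum_(v : V) outdeg u v)%N = size u.
Proof.
rewrite -(size_trace step a) -sum1_size (partition_big fst predT) //=.
by apply: eq_bigr => v _; rewrite size_map size_filter -sum1_count.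
Qed.

(** The tour may be interrupted anywhere, so the bound at each vertex is required for every exit
    count [j]; [pen v] pays for a vertex whose early exits fall short of the rate [c]. *)
Lemma tour_entropy (c : R) (pen : V -> R) :
  (forall v j, (outdeg u0 v <= j <= #|B|)%N ->
    c * (j - outdeg u0 v)%N%:R - pen v <=
      \sum_(outdeg u0 v <= i < j) log_choices (v \in X) i) ->
  c * n%:R - \sum_v pen v <= \sum_(0 <= j < n) ln #|allowed (word j)|%:R.
Proof.
move=> hpen; apply: le_trans (tour_entropy_potential (leqnn n)).
have [uu _ _] := tour_prefix (leqnn n).
have mono v : (outdeg u0 v <= outdeg (word n) v)%N.
  by rewrite /exits trace_cat filter_cat map_cat size_cat leq_addr.
have n_sum : n = (\sum_v (outdeg (word n) v - outdeg u0 v))%N.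
  by rewrite sumnB ?sum_outdeg // size_cat size_mkseq addKn.
rewrite {1}n_sum natr_sum mulr_sumr -sumrB; apply: ler_sum => v _; apply: hpen.
by rewrite mono size_exits_uniq.
Qed.

End TourEntropy.

(** * Trees of last exits *)

Section Arborescence.
Variables (V B : finType) (step : V -> B -> V).
Hypothesis indegree :
  forall x, #|[set e : V * B | target step e == x]| = #|B|.
Variables (a : V) (u0 : seq B).
Local Notation tr := (trace step a u0).
Hypothesis start_uniq : uniq tr.
(* Writing [y] for the common middle part of the edges [p -> step p c], the
   unused edges of the complete bipartite graph around [y] form a connected
   graph. *)
Hypothesis block_connected : forall p c, (p, c) \in tr -> exists p' c',
  [/\ step p' c' = step p c', step p' c = step p c,
      (p, c') \notin tr, (p', c') \notin tr & (p', c) \notin tr].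
Hypothesis all_reach_root : forall Z : {set V}, Z != finset.set0 ->
  (forall p c, p \in Z -> step p c \in Z) -> a \in Z.

Definition rooted (t : V -> B) := forall Z : {set V}, Z != finset.set0 ->
  a \notin Z -> exists2 p, p \in Z & step p (t p) \notin Z.

Lemma unused_edge_leaving (Z : {set V}) : Z != finset.set0 -> a \notin Z ->
  exists p c, [/\ p \in Z, (p, c) \notin tr & step p c \notin Z].
Proof.
move=> Zn0 aZ; apply: contrapT => noleave.
have stay p c : p \in Z -> (p, c) \notin tr -> step p c \in Z.
  by move=> pZ pc; apply: contrapT => /negP nZ; apply: noleave; exists p, c.
pose out := [set e : V * B | (e.1 \in Z) && (e \notin tr)].
pose inn := [set e : V * B | (target step e \in Z) && (e \notin tr)].
have out_inn : out \subset inn.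
  apply/fintype.subsetP => -[p c]; rewrite !inE /target /= => /andP[pZ pc].
  by rewrite stay.
have sideE (P : pred (V * B)) :
    (#|[set e | P e && (e \notin tr)]| + count P tr = #|[set e | P e]|)%N.
  rewrite count_trace_card // addnC -(cardsID [set e in tr] [set e | P e]).
  by congr (_ + _)%N; apply: eq_card => e; rewrite !inE // andbC.
have cardZ (f : V * B -> V) :
    (forall x, #|[set e | f e == x]| = #|B|) ->
    #|[set e | f e \in Z]| = (#|Z| * #|B|)%N.
  move=> fE; rewrite -sum1dep_card (partition_big f (mem Z)) //=.
  rewrite -sum_nat_const; apply: eq_bigr => x xZ; rewrite -(fE x) -sum1dep_card.
  by apply: eq_bigl => e; case: eqP => [->|]; rewrite ?andbT ?andbF ?xZ.
have /eqP out_eq : out == inn.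
  rewrite eqEcard out_inn /=.
  have oE := sideE (fun e => e.1 \in Z); have iE := sideE (fun e => target step e \in Z).
  rewrite cardZ // in iE; rewrite cardZ in oE; last first.
    move=> x; rewrite -[RHS]mul1n -[in RHS]cardsT -(cards1 x) -cardsX.
    by apply: eq_card => e; rewrite !inE andbT.
  have := trace_balance step a u0 (mem Z).
  rewrite !count_map /= (negPf aZ) add0n => bal.
  rewrite -(leq_add2r (count (fun e => target step e \in Z) tr)) iE -oE leq_add2l.
  rewrite -[leqRHS]/(count [pred x | target step x \in Z] tr) bal.
  exact: leq_addr.
have back p c : step p c \in Z -> (p, c) \notin tr -> p \in Z.
  move=> sZ pc; have : (p, c) \in inn by rewrite inE sZ.
  by rewrite -out_eq inE => /andP[].
move/negP: aZ; apply; apply: all_reach_root => // p c pZ.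
have [pc|] := boolP ((p, c) \in tr); last exact: stay.
(* The used edge [(p, c)] is bypassed inside its block: forward along [(p, c')], back along
   [(p', c')], forward along [(p', c)]. *)
have [p' [c' [e1 e2 h1 h2 h3]]] := block_connected pc.
rewrite -e2 stay //; apply: (back _ c') => //; rewrite e1; exact: stay.
Qed.

Lemma rooted_tree_exists : B -> exists t : V -> B,
  (forall p, p != a -> (p, t p) \notin tr) /\ rooted t.
Proof.
move=> c0.
pose partial (D : {set V}) (t : V -> B) :=
  [/\ forall p, p \in D -> p != a -> (p, t p) \notin tr /\ step p (t p) \in D &
   forall Z : {set V}, Z \subset D -> Z != finset.set0 ->
     a \notin Z -> exists2 p, p \in Z & step p (t p) \notin Z].
suff grow m (D : {set V}) t : #|~: D| = m -> a \in D -> partial D t ->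
    exists t', partial finset.setT t'.
  case: (@grow #|~: [set a]| [set a] (fun=> c0)) => [//|||t [t1 t2]].
  - exact: set11.
  - split=> [p /set1P ->|Z Za Zn0]; first by rewrite eqxx.
    by move: Za; rewrite subset1 (negPf Zn0) orbF => /eqP ->; rewrite set11.
  - exists t; split=> [p pa|Z]; last by apply: t2; exact: finset.subsetT.
    by have [] := t1 p (finset.in_setT _) pa.
elim: m D t => [|m IH] D t Dm aD [t1 t2].
  exists t; suff -> : finset.setT = D by [].
  by move/eqP: Dm; rewrite cards_eq0 => /eqP D0; rewrite -[D]finset.setCK D0 finset.setC0.
have [||p [c [pD pc sD]]] := @unused_edge_leaving (~: D).
- by rewrite -card_gt0 Dm.
- by rewrite inE negbK.
rewrite inE in pD; rewrite inE negbK in sD.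
apply: (IH (p |: D) (fun x => if x == p then c else t x)).
- have := cardsC D; have := cardsC (p |: D); rewrite cardsU1 pD Dm; lia.
- by rewrite inE aD orbT.
split=> [q|Z ZD Zn0 aZ].
  rewrite !inE; case: eqP => [-> _ _|_ /= qD qa]; first by rewrite pc sD orbT.
  by have [-> ->] := t1 q qD qa; rewrite orbT.
have [Zp0|Zp0] := eqVneq (Z :\ p) finset.set0.
  have Zp : Z = [set p].
    by move/eqP: Zp0; rewrite finset.setD_eq0 subset1 (negPf Zn0) orbF => /eqP.
  exists p; rewrite Zp ?set11 // inE eqxx.
  by apply: contraNneq pD => <-.
have [|||q] := t2 (Z :\ p) => //.
- by rewrite subDset.
- by rewrite !inE (negPf aZ) andbF.
rewrite !inE => /andP[qp qZ] h; exists q => //; rewrite (negPf qp).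
have qD : q \in D by have := fintype.subsetP ZD q qZ; rewrite !inE (negPf qp).
have qa : q != a by apply: contraNneq aZ => <-.
have [_ sqD] := t1 q qD qa.
by move: h; rewrite negb_and negbK; case: eqP => // sp; rewrite sp (negPf pD) in sqD.
Qed.

End Arborescence.

Lemma rooted_trap_free (V B : finType) (step : V -> B -> V) a (t : V -> B) :
  rooted step a t -> trap_free step a t finset.set0.
Proof. by move=> rt Z Zn0 aZ; have [p pZ h] := rt Z Zn0 aZ; exists p; rewrite // inE. Qed.

(** * Modifying a tree, and cutting the cycles of a map *)

Section Rerouting.
Variables (V B : finType) (step : V -> B -> V) (a : V).
Local Notation rooted := (rooted step a).

Definition reroute (t : V -> B) p c : V -> B :=
  fun x => if x == p then c else t x.

(* A trap of the first rerouted tree and one of the second unite to a trap of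
   the original tree. *)
Lemma reroute_rooted (t : V -> B) p q :
  (forall c, step p c = step q c) -> rooted t ->
  rooted (reroute t p (t q)) \/ rooted (reroute t q (t p)).
Proof.
move=> pq rt; apply: contrapT => /not_orP[].
have trap t' : ~ rooted t' -> exists Z : {set V}, [/\ Z != finset.set0, a \notin Z &
    forall x, x \in Z -> step x (t' x) \in Z].
  move=> /existsNP[Z] /not_implyP[Zn0] /not_implyP[aZ] nex; exists Z; split=> //.
  by move=> x xZ; apply: contrapT => /negP h; apply: nex; exists x.
move=> /trap[Z0 [Z0n aZ0 tr0]] /trap[Z1 [Z1n aZ1 tr1]].
have n0 Z : Z != finset.set0 -> a \notin Z -> ~ forall x, x \in Z -> step x (t x) \in Z.
  by move=> Zn0 aZ h; have [x /h ->] := rt Z Zn0 aZ.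
have pZ0 : p \in Z0.
  apply: contrapT => /negP pZ0; apply: (n0 Z0) => // x xZ; have := tr0 x xZ.
  by rewrite /reroute; case: eqP => // xp; rewrite -xp xZ in pZ0.
have qZ1 : q \in Z1.
  apply: contrapT => /negP qZ1; apply: (n0 Z1) => // x xZ; have := tr1 x xZ.
  by rewrite /reroute; case: eqP => // xp; rewrite -xp xZ in qZ1.
(* Since [p] and [q] have the same successors, the original tree edge of [q] ends in [Z0] and that
   of [p] in [Z1], so [t] maps the union into itself. *)
have sp := tr0 p pZ0; have sq := tr1 q qZ1.
rewrite /reroute eqxx pq in sp; rewrite /reroute eqxx -pq in sq.
apply: (n0 (Z0 :|: Z1)) => [||x].
- by rewrite -card_gt0 (leq_trans _ (subset_leq_card (finset.subsetUl _ _))) ?card_gt0.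
- by rewrite inE negb_or aZ0.
have [->|xp] := eqVneq x p; first by rewrite !inE sq orbT.
have [->|xq] := eqVneq x q; first by rewrite !inE sp.
by rewrite !inE => /orP[/tr0|/tr1]; rewrite /reroute ?(negPf xp) ?(negPf xq) => ->; rewrite ?orbT.
Qed.

End Rerouting.

Section CycleHitting.
Variables (V : finType) (g : V -> V).

(* The least vertices of the long cycles: the first [q] iterates of two of them
   are all distinct. *)
Lemma long_cycle_hitting (q : nat) : exists R : {set V},
  (q * #|R| <= #|V|)%N /\
  forall Z : {set V}, Z != finset.set0 -> (forall v, v \in Z -> g v \in Z) ->
    (exists2 v, v \in Z & exists2 i, (0 < i < q)%N & iter i g v = v) \/
    exists2 v, v \in Z & v \in R.
Proof.
have iter_back u i j : iter j g u = u -> (0 < j)%N ->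
    iter (j * i - i) g (iter i g u) = u.
  move=> ju j0; rewrite -iterD subnK ?leq_pmull // mulnC.
  by elim: i => // i IH; rewrite mulSn iterD IH.
pose least u := forall i, (enum_rank u <= enum_rank (iter i g u))%N.
pose R := [set u | `[< [/\ forall i, (0 < i < q)%N -> iter i g u != u,
                          exists2 j, (0 < j)%N & iter j g u = u & least u] >]].
exists R; split=> [|Z Zn0 gZ].
  (* Injectivity of [f] on the product of [R] with ['I_q] is what bounds [q * #|R|]: two points of
     [R] on one cycle are both its least vertex, and no period is shorter than [q]. *)
  pose f (p : V * 'I_q) := iter p.2 g p.1.
  rewrite mulnC -[q in X in (_ * X <= _)%N]card_ord -[#|'I_q|]cardsT -cardsX.
  rewrite -(card_in_imset (f := f)) ?max_card // => -[u i] [u' i'].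
  rewrite !inE !andbT /f /= => /asboolP[nu [j j0 ju] lu] /asboolP[nu' [j' j0' ju'] lu'] e.
  have uu' : u = u'.
    apply/enum_rank_inj/val_inj/eqP; rewrite /= eqn_leq; apply/andP; split.
      by rewrite -(iter_back u' i' j' ju' j0') -e -iterD lu.
    by rewrite -(iter_back u i j ju j0) e -iterD lu'.
  rewrite -{u' nu' j' j0' ju' lu'}uu' in e *; congr pair; apply/val_inj.
  wlog ii' : i i' e / (i <= i')%N.
    by move=> h; case: (leqP i i') => [|/ltnW] /h; [exact | move=> ->].
  apply/eqP; rewrite eqn_leq ii' /= -subn_eq0; apply: contraT => di.
  have := nu (i' - i)%N; rewrite lt0n di (leq_ltn_trans (leq_subr _ _)) // => /(_ isT).
  rewrite -{1}(iter_back u i j ju j0) -!iterD.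
  rewrite (_ : (_ + _)%N = (j * i - i + i')%N); last by have := leq_pmull i j0; lia.
  by rewrite iterD -e (iter_back u i j) // eqxx.
have [v0 v0Z] := set0Pn _ Zn0.
have iterZ i v : v \in Z -> iter i g v \in Z by move=> vZ; elim: i => //= i; exact: gZ.
have [i [j [ij e]]] : exists i j, (i < j)%N /\ iter i g v0 = iter j g v0.
  pose f (i : 'I_#|V|.+1) := iter i g v0.
  have /injectivePn[i [j ij e]] : ~~ injectiveb f.
    by apply/injectiveP => /leq_card; rewrite card_ord ltnn.
  by case: (ltngtP i j) ij => [ij|ij|/val_inj ->]; rewrite ?eqxx //;
    [exists i, j | exists j, i].
pose v := iter i g v0.
have vv : iter (j - i) g v = v by rewrite -iterD subnK 1?ltnW.
set p := (j - i)%N in vv.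
have p0 : (0 < p)%N by rewrite subn_gt0.
have iter_mod n : iter n g v = iter (n %% p)%N g v.
  rewrite {1}(divn_eq n p) addnC iterD; congr iter.
  by elim: (n %/ p)%N => // m IH; rewrite mulSn iterD IH.
case: (arg_minnP (P := fun k : 'I_p => true) (i0 := Ordinal p0)
  (fun k => enum_rank (iter k g v))) => // k _ kmin.
set u := iter k g v; have uZ : u \in Z by exact: (iterZ _ _ (iterZ _ _ v0Z)).
have lu : least u.
  by move=> n; rewrite -iterD iter_mod (kmin (Ordinal (ltn_pmod (n + k) p0))).
have pu : iter p g u = u by rewrite -iterD addnC iterD vv.
case: (pselect (forall i, (0 < i < q)%N -> iter i g u != u)) => [nu|].
  by right; exists u; rewrite // inE; apply/asboolP; split=> //; exists p.
move=> /existsNP[n /not_implyP[nq /negP/negPn/eqP un]].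
by left; exists u => //; exists n.
Qed.

End CycleHitting.

(** * The de Bruijn graph *)

Lemma uniq_map_inj_in (T1 T2 : eqType) (f : T1 -> T2) (s : seq T1) :
  uniq (map f s) -> {in s &, injective f}.
Proof.
elim: s => //= z s IH /andP[zs us] x y; rewrite !inE.
move=> /orP[/eqP->|xs] /orP[/eqP->|ys] // e; last exact: IH.
- by rewrite e map_f in zs.
- by rewrite -e map_f in zs.
Qed.

Section DeBruijnGraph.
Variables (B : finType) (M : nat).
Local Notation V := (M.+1.-tuple B).
Local Notation W := (M.-tuple B).
Implicit Types (v p : V) (y : W) (c : B).

Definition dbstep v c : V := [tuple of rcons (behead v) c].
(** This is the block of the edges leaving [v]: the vertices [c :: y] and the vertices [snoc y d]
    are the two sides of the complete bipartite graph around [y]. *)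
Definition tailw v : W := [tuple of behead v].
Definition snoc y c : V := [tuple of rcons y c].

Lemma dbstepE v c : dbstep v c = snoc (tailw v) c.
Proof. exact/val_inj. Qed.

Lemma snoc_inj y c y' c' : snoc y c = snoc y' c' -> y = y' /\ c = c'.
Proof. by move=> /(congr1 val) /= /rcons_inj[/val_inj -> ->]. Qed.

Lemma snocP v : exists y c, v = snoc y c.
Proof.
case: v => s; case/lastP: s => [|s c] szs //.
have szs' : size s == M by move: (szs); rewrite size_rcons.
by exists (Tuple szs'), c; apply/val_inj.
Qed.

Lemma tailw_cons c y : tailw [tuple of c :: y] = y.
Proof. exact/val_inj. Qed.

Lemma cons_tailw v : v = [tuple of thead v :: tailw v].
Proof. by rewrite [LHS]tuple_eta; apply/val_inj. Qed.

Lemma db_indegree v : #|[set e : V * B | target dbstep e == v]| = #|B|.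
Proof.
have [y [d ->]] := snocP v.
pose f c : V * B := ([tuple of c :: y], d).
rewrite -(card_imset (f := f) predT) => [|c c' [] //].
apply: eq_card => -[p c]; rewrite inE /target /= dbstepE.
apply/eqP/imsetP => [/snoc_inj[py cd]|[c' _ [-> ->]]]; last by rewrite tailw_cons.
by exists (thead p); rewrite // /f -cd -py -cons_tailw.
Qed.

Lemma endptE v u : val (endpt dbstep v u) = drop (size u) (v ++ u).
Proof.
elim: u v => [|c u IH] v /=; first by rewrite cats0 drop0.
by rewrite IH /=; case/tupleP: v => x v /=; rewrite cat_rcons.
Qed.

Lemma endpt_all v v' : endpt dbstep v v' = v'.
Proof. by apply/val_inj; rewrite endptE size_tuple drop_size_cat ?size_tuple. Qed.

Lemma db_all_reach (Z : {set V}) a : Z != finset.set0 ->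
  (forall p c, p \in Z -> dbstep p c \in Z) -> a \in Z.
Proof.
move=> /set0Pn[p pZ] cZ; rewrite -(endpt_all p a).
by elim: (val a) p pZ => //= c u IH p pZ; apply/IH/cZ.
Qed.

Definition factor (m : nat) (s : seq B) i := take m (drop i s).

(** Edges are words of length [M.+2], so a walk without repeated edge is a word without repeated
    factor of that length. *)
Lemma trace_factors v u :
  [seq rcons (val e.1) e.2 | e <- trace dbstep v u] =
  [seq factor M.+2 (v ++ u) i | i <- iota 0 (size u)].
Proof.
elim: u v => //= c u IH v; congr cons.
  rewrite /factor drop0 take_cat size_tuple ltnNge leqnSn /= subSnn.
  by rewrite /= take0 cats1.
rewrite IH -[1%N]addn0 iotaDl -map_comp; apply: eq_map => i /=.
rewrite /factor; case/tupleP: v => x v /=.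
by rewrite cat_rcons.
Qed.

(** The tail of a vertex begins one letter after the vertex, hence the position [i.+1]. *)
Lemma trace_tails v u :
  [seq val (tailw e.1) | e <- trace dbstep v u] =
  [seq factor M (v ++ u) i.+1 | i <- iota 0 (size u)].
Proof.
elim: u v => //= c u IH v; congr cons.
  rewrite /factor; case/tupleP: v => x v /=; rewrite drop0.
  by rewrite -[M in take M](size_tuple v) take_size_cat.
rewrite IH -[1%N]addn0 iotaDl -map_comp; apply: eq_map => i /=.
by rewrite /factor; case/tupleP: v => x v /=; rewrite cat_rcons.
Qed.

Lemma other_letter c : (1 < #|B|)%N -> exists c', c' != c.
Proof.
move=> B2; have : [set~ c] != finset.set0 by rewrite -card_gt0 cardsC1; lia.
by move=> /set0Pn[c']; rewrite !inE => h; exists c'.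
Qed.

Section Start.
Hypothesis B_gt1 : (1 < #|B|)%N.
Variables (a : V) (u0 : seq B).
Local Notation tr := (trace dbstep a u0).
Hypothesis tails_uniq : uniq [seq tailw e.1 | e <- tr].

Lemma tails_uniq_trace : uniq tr.
Proof. exact: map_uniq tails_uniq. Qed.

Lemma tails_inj e e' : e \in tr -> e' \in tr -> tailw e.1 = tailw e'.1 -> e = e'.
Proof. by move=> etr e'tr ee'; exact: (uniq_map_inj_in tails_uniq etr e'tr ee'). Qed.

Lemma db_block_connected p c : (p, c) \in tr -> exists p' c',
  [/\ dbstep p' c' = dbstep p c', dbstep p' c = dbstep p c,
      (p, c') \notin tr, (p', c') \notin tr & (p', c) \notin tr].
Proof.
move=> pc; have [c' c'c] := other_letter c B_gt1.
have [d dp] := other_letter (thead p) B_gt1.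
pose p' : V := [tuple of d :: tailw p].
have tp' : tailw p' = tailw p by rewrite tailw_cons.
have p'p : p' != p by apply: contraNneq dp => <-; rewrite theadE.
exists p', c'; rewrite !dbstepE tp'; split=> //; apply/negP => h.
- by have [] := tails_inj h pc erefl => /eqP; rewrite (negPf c'c).
- by have [/eqP] := tails_inj h pc tp'; rewrite (negPf p'p).
- by have [/eqP] := tails_inj h pc tp'; rewrite (negPf p'p).
Qed.

Lemma db_rooted_tree : exists t : V -> B,
  (forall p, p != a -> (p, t p) \notin tr) /\ rooted dbstep a t.
Proof.
apply: rooted_tree_exists (thead a) => //.
- exact: db_indegree.
- exact: tails_uniq_trace.
- exact: db_block_connected.
- by move=> Z; exact: db_all_reach.
Qed.

(** The second clause concerns the start [a], which the walk visits without entering it through a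
    block; both clauses together keep the walk away from every [snoc y c]. *)
Definition unvisited : {set W} :=
  [set y | (y \notin [seq tailw e.1 | e <- tr]) && [forall c, snoc y c != a]].

Lemma unvisited_source y c e : y \in unvisited -> e \in tr -> e.1 != snoc y c.
Proof.
rewrite inE => /andP[yt /forallP ya] etr; apply: contraNneq yt => ey.
have : e.1 \in rcons (map fst tr) (endpt dbstep a u0).
  by rewrite mem_rcons inE (map_f fst etr) orbT.
rewrite -trace_vertices inE ey (negPf (ya c)) /= => /mapP[e' e'tr].
by rewrite /target dbstepE => /snoc_inj[-> _]; apply/mapP; exists e'.
Qed.

Lemma card_unvisited : (#|B| ^ M <= #|unvisited| + size u0 + 1)%N.
Proof.
rewrite -card_tuple -(cardsC unvisited) -addnA leq_add2l.
have [y0 [d0 ay]] := snocP a.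
rewrite -(size_trace dbstep a) -(size_map (fun e => tailw e.1)) addn1.
rewrite -[(size _).+1]/(size (y0 :: _)) (leq_trans _ (card_size _)) //.
apply/subset_leq_card/fintype.subsetP => y; rewrite !inE negb_and !negbK.
case/orP => [-> |]; first by rewrite orbT.
rewrite negb_forall => /existsP[c]; rewrite negbK ay => /eqP/snoc_inj[-> _].
by rewrite eqxx.
Qed.

End Start.
End DeBruijnGraph.

Lemma two_letters (B : finType) (c c' d : B) :
  #|B| = 2%N -> c != d -> c' != d -> c = c'.
Proof.
move=> B2 cd c'd; apply/eqP/negPn/negP => cc'.
have : (#|[set c; c'; d]| <= #|B|)%N by exact: max_card.
by rewrite B2 -finset.setUA cardsU1 cards2 !inE (negPf cc') (negPf cd) c'd.
Qed.

(** * The binary alphabet: merged trees and free last exits *)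

Section BinaryTree.
Variables (B : finType) (M : nat).
Local Notation V := (M.+1.-tuple B).
Local Notation W := (M.-tuple B).
Local Notation step := (@dbstep B M).
Hypothesis B_eq2 : #|B| = 2%N.
Variables (a : V) (u0 : seq B).
Local Notation tr := (trace step a u0).
Local Notation unvisited := (unvisited a u0).
Hypothesis tails_uniq : uniq [seq tailw e.1 | e <- tr].

Let B_gt1 : (1 < #|B|)%N. Proof. by rewrite B_eq2. Qed.

Lemma merged_tree : exists t : V -> B,
  [/\ forall p, p != a -> (p, t p) \notin tr, rooted step a t &
      forall p q, tailw p \in unvisited -> tailw p = tailw q -> t p = t q].
Proof.
suff H (s : seq W) : {subset s <= unvisited} -> exists t : V -> B,
    [/\ forall p, p != a -> (p, t p) \notin tr, rooted step a t &
        forall p q, tailw p \in s -> tailw p = tailw q -> t p = t q].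
  have [|t [t1 t2 t3]] := H (enum unvisited); first by move=> y; rewrite mem_enum.
  by exists t; split=> // p q yp; apply: t3; rewrite mem_enum.
elim: s => [_|y s IH sub]; first by have [t [t1 t2]] := db_rooted_tree B_gt1 tails_uniq; exists t.
have [z zs|t [t1 t2 t3]] := IH; first by apply: sub; rewrite inE zs orbT.
have yun : y \in unvisited by apply: sub; rewrite mem_head.
have fresh p c : tailw p = y -> (p, c) \notin tr.
  move=> py; move: yun; rewrite inE => /andP[h _]; apply: contraNN h => pc.
  by apply/mapP; exists (p, c).
have merge p q : p != q -> tailw p = y -> tailw q = y ->
    rooted step a (reroute t p (t q)) -> exists t : V -> B,
    [/\ forall p, p != a -> (p, t p) \notin tr, rooted step a t &
        forall p q, tailw p \in y :: s -> tailw p = tailw q -> t p = t q].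
  move=> pq py qy rt; exists (reroute t p (t q)); split=> // x.
    by move=> xa; rewrite /reroute; case: eqP => [->|_]; [exact: fresh | exact: t1].
  have tq z : tailw z = y -> reroute t p (t q) z = t q.
    move=> zy; rewrite /reroute; case: eqP => // /eqP zp; congr t.
    rewrite [z]cons_tailw [q]cons_tailw zy qy; congr [tuple of _ :: _].
    have neq x1 x2 : tailw x1 = y -> tailw x2 = y -> x1 != x2 -> thead x1 != thead x2.
      move=> h1 h2; apply: contraNN => /eqP h.
      by rewrite [x1]cons_tailw [x2]cons_tailw h h1 h2.
    by apply: (two_letters (d := thead p)) B_eq2 _ _; apply: neq => //; rewrite eq_sym.
  move=> z; have [xy _ xz|xy] := eqVneq (tailw x) y; first by rewrite !tq // -xz.
  rewrite inE (negPf xy) => /= xs xz; rewrite /reroute.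
  have np w : tailw w != y -> (w == p) = false.
    by move=> wy; apply: contraNF wy => /eqP ->; rewrite py.
  by rewrite !np -?xz //; apply: t3.
have [c [d cd]] : exists c d : B, c != d.
  by have [d dc] := other_letter (thead a) B_gt1; exists d, (thead a).
pose p : V := [tuple of c :: y]; pose q : V := [tuple of d :: y].
have [py qy] : tailw p = y /\ tailw q = y by rewrite !tailw_cons.
have pq : p != q by apply: contraNneq cd => /(congr1 (@thead _ _)); rewrite !theadE => ->.
have [h|h] : rooted step a (reroute t p (t q)) \/ rooted step a (reroute t q (t p)).
- by apply: reroute_rooted t2 => e; rewrite !dbstepE py qy.
- exact: merge h.
- by apply: merge h; rewrite // eq_sym.
Qed.

(** Each application of [g] shifts the word by one letter, so [iter i g v = v] makes [v] periodic
    with period [i]; with [i < q], the period and the first [q] letters determine [v]. *)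
Lemma card_short_cycles (g : V -> V) (q : nat) :
  (forall v, exists c, g v = step v c) ->
  (#|[set v | [exists i : 'I_q, (0 < i)%N && (iter i g v == v)]]| <= q * 2 ^ q)%N.
Proof.
move=> gstep; have c0 := thead a.
have period i v j : iter i g v = v -> (i + j < M.+1)%N ->
    nth c0 v (i + j) = nth c0 v j.
  move=> iv ij; have [u [su vu]] : exists u, size u = i /\ iter i g v = endpt step v u.
    elim: i {iv ij} => [|i [u [su e]]]; first by exists [::].
    have [c gc] := gstep (iter i g v); exists (rcons u c).
    by rewrite size_rcons su /endpt -cats1 foldl_cat /= -/(endpt _ _ _) -e -gc.
  rewrite -[in RHS]iv vu endptE su nth_drop nth_cat size_tuple ij.
  by [].
case: q => [|q]; first rewrite mul0n leqn0 cards_eq0.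
  by apply/eqP/finset.setP => v; rewrite !inE; apply/existsP => -[[]].
set S := [set v | _].
pose per (v : V) : 'I_q.+1 := odflt ord0 [pick i : 'I_q.+1 | (0 < i)%N && (iter i g v == v)].
have perP v : v \in S -> (0 < per v)%N /\ iter (per v) g v = v.
  rewrite inE /per; case: pickP => [i /andP[i0 /eqP e] _|h /existsP[i]]; first by [].
  by rewrite h.
pose f v : 'I_q.+1 * q.+1.-tuple B := (per v, [tuple nth c0 v j | j < q.+1]).
have f_inj : {in S &, injective f}.
  move=> v v' /perP[p0 pv] /perP[p0' pv'] e.
  have e1 : per v = per v' := congr1 fst e.
  have e2 := congr1 snd e; rewrite -e1 in p0' pv'.
  apply/val_inj/(@eq_from_nth _ c0); first by rewrite !size_tuple.
  move=> j; rewrite size_tuple; elim/ltn_ind: j => j IH jM.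
  have [jp|pj] := ltnP j (per v).
    have jq : (j < q.+1)%N by exact: ltn_trans jp (ltn_ord _).
    have := congr1 (fun t => tnth t (Ordinal jq)) e2.
    by rewrite !tnth_mktuple.
  rewrite -(subnKC pj) !period ?subnKC //; apply: IH; lia.
rewrite -(card_in_imset f_inj) (leq_trans (max_card _)) //.
by rewrite card_prod card_ord card_tuple B_eq2.
Qed.

(* After merging, each unvisited block [y] has a leaf, whose last exit can be
   left free. A cycle of free exits can only run through leaves, where it
   follows the map [g]; it is cut by freezing one vertex of each cycle of [g]. *)
Lemma binary_free_exits (q : nat) : exists (t : V -> B) (X : {set V}),
  [/\ forall p, p != a -> (p, t p) \notin tr, trap_free step a t X,
      forall x e, x \in X -> e \in tr -> e.1 != x &
      (q * 2 ^ M <= q * (#|X| + size u0 + 1 + q * 2 ^ q) + 2 ^ M.+1)%N].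
Proof.
have [t [t1 t2 t3]] := merged_tree.
have /(_ _)/cid other_ex c := other_letter c B_gt1.
pose other c := projT1 (other_ex c).
have otherP c : other c != c := projT2 (other_ex c).
pose fill (y : W) : V := [tuple of thead a :: y].
pose leaf y : V := snoc y (other (t (fill y))).
pose L := leaf @: unvisited.
pose g v := step v (other (t v)).
have [R [cR hitR]] := long_cycle_hitting g q.
pose S := [set v | [exists i : 'I_q, (0 < i)%N && (iter i g v == v)]].
have cS : (#|S| <= q * 2 ^ q)%N by apply: card_short_cycles => v; exists (other (t v)).
(* Removing [R] cuts the long cycles of [g], removing [S] the short ones. *)
pose X := (L :\: R) :\: S.
have XL x : x \in X -> x \in L by rewrite !finset.in_setD => /and3P[].
exists t, X; split=> // [Z Zn0 aZ|x e /XL/imsetP[y yun ->]|].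
- apply: contrapT => /forall2NP trap.
  have tlast p : tailw p \in unvisited -> t (fill (tailw p)) = t p.
    by move=> yun; apply: t3; rewrite tailw_cons.
  (* From some [p] in [Z] outside [X] the tree edge leaves that part of [Z]; staying in [Z], it
     would end at a leaf, but the leaf after a block avoids the common tree letter of its two
     predecessors. *)
  have ZX : Z \subset X.
    rewrite -finset.setD_eq0; apply/negPn/negP => Z'n0.
    have [|p] := t2 _ Z'n0; first by rewrite inE (negPf aZ) andbF.
    rewrite finset.in_setD => /andP[pX pZ]; rewrite finset.in_setD.
    have := trap p; rewrite pZ (negPf pX) => -[//|/negP/negPn ->].
    rewrite andbT negbK => /XL/imsetP[y yun].
    rewrite dbstepE => /snoc_inj[py tp]; rewrite -py in yun tp.
    by have := otherP (t (fill (tailw p))); rewrite -tp tlast // eqxx.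
  (* Here [v] is free but has a successor in [Z]. This successor is a leaf, so the letter read is
     not the tree letter of [v], and the successor is [g v]. *)
  have gZ v : v \in Z -> g v \in Z.
    move=> vZ; have vX := fintype.subsetP ZX _ vZ.
    have := trap v; rewrite vZ vX => -[//|/negP].
    rewrite negb_forall => /existsP[c]; rewrite negbK => cZ.
    have /XL/imsetP[y yun] := fintype.subsetP ZX _ cZ.
    rewrite dbstepE => /snoc_inj[vy cE]; rewrite -vy in yun cE.
    by rewrite /g -(tlast v) // -cE.
  have [[v vZ [i /andP[i0 iq] iv]]|[v vZ vR]] := hitR Z Zn0 gZ;
    have := fintype.subsetP ZX _ vZ; rewrite !finset.in_setD.
    have -> : v \in S by rewrite inE; apply/existsP; exists (Ordinal iq); rewrite /= i0 iv eqxx.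
    by [].
  by rewrite vR andbF.
- exact: unvisited_source.
have cL : #|L| = #|unvisited| by rewrite card_imset // => y y' /snoc_inj[].
have cun := card_unvisited a u0; rewrite B_eq2 -cL in cun.
have cX : (#|L| <= #|X| + #|R| + #|S|)%N.
  have := cardsID S (L :\: R); have := cardsID R L.
  have := subset_leq_card (finset.subsetIr L R).
  have := subset_leq_card (finset.subsetIr (L :\: R) S).
  rewrite /X; lia.
rewrite card_tuple B_eq2 in cR.
have h : (2 ^ M <= #|X| + size u0 + 1 + q * 2 ^ q + #|R|)%N.
  by move: cun cX cS; clear; lia.
rewrite (leq_trans (leq_mul (leqnn q) h)) // mulnDr leq_add2l.
exact: cR.
Qed.

End BinaryTree.

(** * Entropy of the extensions *)

Section PhaseTree.
Variable R : realType.

Lemma sum_ln_fact (m : nat) :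
  \sum_(0 <= i < m.+1) ln (m - i)%N%:R = ln (m`!)%:R :> R.
Proof.
elim: m => [|m IH]; first by rewrite big_nat1 subnn fact0 ln0 // ln1.
rewrite big_nat_recl // subn0 factS natrM lnM ?posrE ?ltr0n ?fact_gt0 //.
by rewrite -IH.
Qed.

(** If [f] is still at least [c] at [j], all earlier terms are; otherwise the terms from [j] on are
    at most [c] and the surplus lies before [j]. *)
Lemma nonincreasing_partial_sum (f : nat -> R) (c : R) (o j k : nat) :
  {homo f : m n / (m <= n)%N >-> n <= m} -> (o <= j <= k)%N ->
  c * (k - o)%N%:R <= \sum_(o <= i < k) f i ->
  c * (j - o)%N%:R <= \sum_(o <= i < j) f i.
Proof.
move=> fmono /andP[oj jk] tot.
have const_sum m n : (m <= n)%N -> \sum_(m <= i < n) c = c * (n - m)%N%:R.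
  by move=> _; rewrite big_const_nat iter_addr_0 mulr_natr.
have [cf|fc] := leP c (f j).
  rewrite -const_sum //; apply: ler_sum_nat => i /andP[_ ij].
  by rewrite (le_trans cf) // fmono // ltnW.
have : \sum_(j <= i < k) f i <= c * (k - j)%N%:R.
  rewrite -const_sum //; apply: ler_sum_nat => i /andP[ji _].
  by rewrite (le_trans _ (ltW fc)) // fmono.
move: tot; rewrite (big_cat_nat oj jk) /=.
rewrite (_ : (k - o)%N = ((j - o) + (k - j))%N); last by lia.
by rewrite natrD mulrDr; lra.
Qed.

(* [t] steps of the tour extending a word of length about [k ^ n] have entropy
   at least [phase_rate k * (t - phase_loss k * k ^ n - O(1))]: the loss comes
   from the vertices without choice, which may be visited first. *)
Definition phase_rate (k : nat) : R :=
  if k == 2%N then ln 2 / 2 else if k == 3%N then ln 2 / 3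
  else ln ((k - 2)`!)%:R / k%:R.

Definition phase_loss (k : nat) : R :=
  if k == 2%N then 41 / 8 else if k == 3%N then 2 else 0.

Lemma phase_rate_ge0 k : 0 <= phase_rate k.
Proof.
rewrite /phase_rate; case: ifP => _; [|case: ifP => _]; apply: divr_ge0;
  by rewrite ?ln_ge0 ?ler1n ?fact_gt0.
Qed.

Variable B : finType.
Local Notation k := #|B|.
Local Notation c := (phase_rate k).
Local Notation choices := (log_choices R B).
Hypothesis B_gt1 : (1 < k)%N.

Lemma log_choices_mono free :
  {homo choices free : m n / (m <= n)%N >-> n <= m}.
Proof. by move=> m n mn; apply: le_ln_nat; case: free => /=; lia. Qed.

Lemma log_choices_ge0 free i : 0 <= choices free i.
Proof.
rewrite /log_choices; case: (if free then _ else _) => [|n]; first by rewrite ln0.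
by rewrite ln_ge0 ?ler1n.
Qed.

Lemma sum_log_choices o : (o < k)%N ->
  \sum_(o <= i < k) choices false i = ln ((k.-1 - o)`!)%:R.
Proof.
move=> ok; rewrite -sum_ln_fact -{1}(add0n o) big_addn.
rewrite (_ : (k - o)%N = (k.-1 - o).+1); last by lia.
by apply: eq_bigr => i _; rewrite /log_choices; congr (ln _%:R); lia.
Qed.

Variable M : nat.
Local Notation V := (M.+2.-tuple B).
Local Notation step := (@dbstep B M.+1).
Variables (a : V) (u0 : seq B).
Local Notation tr := (trace step a u0).
Local Notation outdeg v := (size (exits step a u0 v)).
Hypothesis tails_uniq : uniq [seq tailw e.1 | e <- tr].
Hypothesis size_u0 : (size u0 <= k ^ M)%N.

Lemma outdeg_le1 v : (outdeg v <= 1)%N.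
Proof.
rewrite leqNgt; apply/negP => h; have tu := tails_uniq_trace tails_uniq.
have := uniq_exits v tu; case E : (exits step a u0 v) h => [|x [|y s]] // _.
have xe : (v, x) \in tr by rewrite -mem_exits E mem_head.
have ye : (v, y) \in tr by rewrite -mem_exits E !inE eqxx orbT.
by have [->] := tails_inj tails_uniq xe ye erefl; rewrite /= mem_head.
Qed.

Definition penalty_bound (X : {set V}) (pen : V -> R) := forall v j,
  (outdeg v <= j <= k)%N ->
  c * (j - outdeg v)%N%:R - pen v <=
    \sum_(outdeg v <= i < j) choices (v \in X) i.

Lemma phase_tree_plain : k != 2%N -> exists t : V -> B, exists pen : V -> R,
  [/\ forall p, p != a -> (p, t p) \notin tr, trap_free step a t finset.set0,
      penalty_bound finset.set0 pen &
      \sum_v pen v <= c * (phase_loss k * (k ^ M)%N%:R)].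
Proof.
move=> k2; have [t [t1 t2]] := db_rooted_tree B_gt1 tails_uniq.
exists t; have tf := rooted_trap_free t2.
have [k3|k3] := eqVneq k 3%N.
  have cE : phase_rate 3 = ln 2 / 3 by [].
  have l2 : 0 <= ln 2 :> R by rewrite ln_ge0 // ler1n.
  have l0 : ln 0%:R = 0 :> R by rewrite ln0.
  exists (fun v => 2 * c * (outdeg v)%:R); split=> // [v j|].
    rewrite inE k3; have := outdeg_le1 v; case: (outdeg v) => [|[|//]] _.
      rewrite !subn0 mulr0 subr0 cE /index_iota; case: j => [|[|[|[|//]]]] _ /=;
        rewrite ?big_cons big_nil /log_choices ?k3 /= ?subnn ?subn0 ?ln1 ?l0;
        lra.
    move=> /andP[_ j3]; apply: le_trans (_ : 0 <= _); last first.
      by apply: sumr_ge0 => i _; exact: log_choices_ge0.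
    by case: j j3 => [|[|[|[|//]]]] _; rewrite ?subnn ?subn1 /= cE; lra.
  rewrite -mulr_sumr -natr_sum sum_outdeg [2 * c]mulrC -mulrA.
  by rewrite ler_wpM2l ?phase_rate_ge0 // /phase_loss k3 /= ler_wpM2l // ler_nat -k3.
have k4 : (3 < k)%N by lia.
have cE : c = ln ((k - 2)`!)%:R / k%:R.
  by rewrite /phase_rate (negPf k2) (negPf k3).
exists (fun=> 0); split=> // [v j oj|]; last first.
  by rewrite big1 // mulr_ge0 ?phase_rate_ge0 // mulr_ge0 // /phase_loss;
    case: ifP => // _; case: ifP.
rewrite subr0 inE; apply: nonincreasing_partial_sum oj _.
  exact: log_choices_mono.
have o1 := outdeg_le1 v; rewrite sum_log_choices; last by lia.
apply: (@le_trans _ _ (c * k%:R)); first by rewrite ler_wpM2l ?phase_rate_ge0 // ler_nat leq_subr.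
rewrite cE divfK ?pnatr_eq0; last by lia.
rewrite ler_ln ?posrE ?ltr0n ?fact_gt0 // ler_nat.
apply: leq_fact; lia.
Qed.

(** Write [D] for [k ^ M]. The [4 D] vertices have [8 D] exits; [size u0] are used, and free
    vertices carry [2 * #|X|], where [#|X|] is at least [2 D - size u0 - 4 D / q] up to a constant.
    The remaining, choiceless exits number at most [(5 + 8 / q) D] up to a constant. *)
Lemma phase_tree_binary (q : nat) : k = 2%N -> (0 < q)%N ->
  exists t : V -> B, exists X : {set V}, exists pen : V -> R,
  [/\ forall p, p != a -> (p, t p) \notin tr, trap_free step a t X,
      penalty_bound X pen &
      \sum_v pen v <=
        c * ((5 + 8 / q%:R) * (k ^ M)%N%:R + (2 + 2 * (q * 2 ^ q)%N%:R))].
Proof.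
move=> k2 q0; have [t [X [t1 t2 Xfree cX]]] := binary_free_exits k2 tails_uniq q.
have cE : phase_rate 2 = ln 2 / 2 by [].
have l2 : 0 <= ln 2 :> R by rewrite ln_ge0 // ler1n.
have l0 : ln 0%:R = 0 :> R by rewrite ln0.
have outX v : v \in X -> outdeg v = 0%N.
  move=> vX; apply/eqP; rewrite size_exits eqn0Ngt -has_count; apply/hasP => -[w].
  by move=> /mapP[e etr ->] /=; apply/negP; exact: Xfree.
(* The penalty vanishes on [X] and elsewhere charges [c] for every exit not yet used. *)
exists t, X, (fun v => c * (2 - (outdeg v)%:R) - (v \in X)%:R * (2 * c)); split=> // [v j|].
  have [vX|vX] := boolP (v \in X).
    rewrite outX // !subn0 /index_iota k2 cE; case: j => [|[|[|//]]] _ /=;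
      by rewrite ?big_cons big_nil /log_choices ?k2 /= ?subn0 ?ln1; lra.
  move=> oj; apply: le_trans (_ : 0 <= _); last first.
    by apply: sumr_ge0 => i _; exact: log_choices_ge0.
  have /andP[oj1 j2] := oj; rewrite k2 in j2; rewrite mul0r subr0 -mulrBr.
  apply: mulr_ge0_le0; first exact: phase_rate_ge0.
  by rewrite natrB // opprB addrA subrK subr_le0 (ler_nat _ _ 2).
have sum_out : \sum_v (outdeg v)%:R = (size u0)%:R :> R.
  by rewrite -natr_sum sum_outdeg.
have sum_X : \sum_v (v \in X)%:R = #|X|%:R :> R.
  rewrite -sum1_card natr_sum [RHS]big_mkcond /=.
  by apply: eq_bigr => v _; case: (v \in X).
rewrite sumrB -mulr_sumr sumrB sum_out -mulr_suml sum_X sumr_const card_tuple.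
rewrite -(mulr_natr 2 (_ ^ _)%N).
move: cX size_u0; rewrite k2 -!(ler_nat R) !(natrM, natrD, natrX) !exprS.
set D := (2 ^+ M : R); set Q := (2 ^+ q : R); set x := #|X|%:R; set U := (size u0)%:R.
move=> cX UD; have qR : 0 < q%:R :> R by rewrite ltr0n.
have {}cX : 2 * D <= x + U + 1 + q%:R * Q + 4 * (D / q%:R).
  rewrite -(ler_pM2l qR) (le_trans cX) // [leRHS]mulrDr lerD2l.
  by rewrite (mulrCA q%:R) (mulrC q%:R) divfK ?gt_eqF //; lra.
rewrite [x * _](_ : _ = phase_rate 2 * (2 * x)); last by ring.
rewrite -mulrBr ler_wpM2l ?phase_rate_ge0 //.
rewrite (_ : (5 + 8 / q%:R) * D = 5 * D + 8 * (D / q%:R)); last by ring.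
lra.
Qed.

End PhaseTree.

Lemma phase_tree (R : realType) (B : finType) : (1 < #|B|)%N ->
  exists2 C : R, 0 <= C &
  forall M (a : M.+2.-tuple B) (u0 : seq B),
    uniq [seq tailw e.1 | e <- trace (@dbstep B M.+1) a u0] ->
    (size u0 <= #|B| ^ M)%N ->
  exists t, exists X : {set M.+2.-tuple B}, exists pen : M.+2.-tuple B -> R,
  [/\ forall p, p != a -> (p, t p) \notin trace (@dbstep B M.+1) a u0,
      trap_free (@dbstep B M.+1) a t X, penalty_bound a u0 X pen &
      \sum_v pen v <= phase_rate R #|B| * (phase_loss R #|B| * (#|B| ^ M)%N%:R + C)].
Proof.
move=> B1; have [B2|B2] := eqVneq #|B| 2%N; last first.
  exists 0 => // M a u0 tu su; have [t [pen [h1 h2 h3 h4]]] := phase_tree_plain R B1 tu su B2.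
  by exists t, finset.set0, pen; rewrite addr0; split.
(* The binary loss [5 + 8 / q] is then [41 / 8]. *)
have [q q0 q64] : exists2 q : nat, (0 < q)%N & q%:R = 64 :> R by exists 64%N.
exists (2 + 2 * (q * 2 ^ q)%N%:R); first by rewrite addr_ge0 // mulr_ge0.
move=> M a u0 tu su; have [t [X [pen [h1 h2 h3 h4]]]] := phase_tree_binary R tu su B2 q0.
exists t, X, pen; split=> //; apply: le_trans h4 _.
by rewrite ler_wpM2l ?phase_rate_ge0 // q64 /phase_loss B2 /=; lra.
Qed.

Lemma mkseqD (T : Type) (f : nat -> T) m p :
  mkseq f (m + p) = mkseq f m ++ mkseq (fun i => f (m + i)%N) p.
Proof. by rewrite /mkseq iotaD map_cat add0n -{2}(addn0 m) iotaDl -map_comp. Qed.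

(** * One rule for infinite words: chaining the phases *)

Section GlobalRule.
Variables (R : realType) (B : finType) (c0 : B).
Hypothesis B_gt1 : (1 < #|B|)%N.
Local Notation k := #|B|.
Local Notation word i := ((3 * i).+2.-tuple B).
Local Notation step i := (@dbstep B (3 * i).+1).
Variables (C : R) (select : forall i, word i -> seq B -> (word i -> B) * {set word i}).
Hypothesis selectP : forall i (a : word i) u0,
  uniq [seq tailw e.1 | e <- trace (step i) a u0] -> (size u0 <= k ^ (3 * i))%N ->
  let t := (select a u0).1 in let X := (select a u0).2 in
  [/\ forall p, p != a -> (p, t p) \notin trace (step i) a u0,
      trap_free (step i) a t X &
      exists2 pen, penalty_bound a u0 X pen &
      \sum_v pen v <= phase_rate R k * (phase_loss R k * (k ^ (3 * i))%N%:R + C)].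

(* Phase [i] extends a de Bruijn word of order [3 i] (any word of length [2] if
   [i = 0]) to one of order [3 (i + 1)]. *)
Definition phase_start i := if i is 0 then 2%N else (k ^ (3 * i) + 3 * i - 1)%N.

Arguments phase_start : simpl never.

Fixpoint phase m :=
  if m is m'.+1 then
    if m == phase_start (phase m').+1 then (phase m').+1 else phase m'
  else 0%N.

(** Tree and free set are recomputed from the prefix ending at the start of the phase, so the rule
    depends on [s] alone. The fallback to all letters keeps it nonempty for every [s], which the
    splitting of the mass requires. *)
Definition rule (s : seq B) : {set B} :=
  let i := phase (size s) in
  let a : word i := [tuple nth c0 s j | j < (3 * i).+2] in
  let tX := select a (drop (3 * i).+2 (take (phase_start i) s)) in
  let A := allowed (step i) a tX.1 tX.2 (drop (3 * i).+2 s) in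
  if (size s < 2)%N || (A == finset.set0) then finset.setT else A.

Lemma rule_neq0 s : rule s != finset.set0.
Proof.
rewrite /rule; case: ifP => [_|/norP[]//].
by apply/set0Pn; exists c0; rewrite inE.
Qed.

Lemma exp_alphabet_ge i : (3 <= k ^ (3 * i.+1))%N.
Proof.
have h8 : (2 ^ 3 <= k ^ 3)%N by rewrite leq_exp2r.
by rewrite (leq_trans (leq_trans _ h8)) // leq_pexp2l ?mulnS ?leq_addr // ltnW.
Qed.

Lemma phase_startS i : phase_start i.+1 = (k ^ (3 * i).+3 + (3 * i).+2)%N.
Proof.
by rewrite /phase_start mulnS -[(3 + 3 * i)%N]/(3 * i).+3 addnS subn1.
Qed.

Lemma phase_start_ge i : ((3 * i).+2 <= phase_start i)%N.
Proof. by case: i => // i; have := exp_alphabet_ge i; rewrite /phase_start; lia. Qed.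

Lemma size_phase_tail i : (phase_start i - (3 * i).+2 <= k ^ (3 * i))%N.
Proof. by case: i => // i; have := exp_alphabet_ge i; rewrite /phase_start; lia. Qed.

Lemma phase_start_lt i : (phase_start i < phase_start i.+1)%N.
Proof.
rewrite phase_startS; have := size_phase_tail i; have := phase_start_ge i.
have : (k ^ (3 * i) < k ^ (3 * i).+3)%N by rewrite ltn_exp2l ?B_gt1 //; lia.
lia.
Qed.

Lemma phase_small m : (m < 2)%N -> phase m = 0%N.
Proof.
have s1 : (2 < phase_start 1)%N := phase_start_lt 0.
by case: m => [|[|]] //= _; case: eqP s1 => // <-.
Qed.

Lemma phaseP m : (m < phase_start (phase m).+1)%N /\
  ((2 <= m)%N -> (phase_start (phase m) <= m)%N).
Proof.
have s1 : (2 < phase_start 1)%N := phase_start_lt 0.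
elim: m => [|m [IH1 IH2]]; first by split=> //; apply: leq_trans s1.
rewrite [phase m.+1]/=; case: eqP => [mE|/eqP mE].
  by rewrite -mE leqnn; split=> //; rewrite {1}mE phase_start_lt.
split; first by rewrite ltn_neqAle mE.
move=> m1; have [m2|m2] := leqP 2 m; first exact: leqW (IH2 m2).
by have -> : m = 1%N; [lia | rewrite phase_small].
Qed.

Variable omega : nat -> B.
Local Notation w := (mkseq omega).
Variable n : nat.
Hypothesis omega_rule : forall m, (m < n)%N -> omega m \in rule (w m).

Definition phase_word i : word i := [tuple omega j | j < (3 * i).+2].
Definition phase_tail i m := drop (3 * i).+2 (w m).

Lemma phase_wordK i m : ((3 * i).+2 <= m)%N -> phase_word i ++ phase_tail i m = w m.
Proof.
move=> im; rewrite /phase_tail -[RHS](cat_take_drop (3 * i).+2); congr (_ ++ _).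
rewrite /= -[in RHS](subnKC im) /mkseq iotaD map_cat take_size_cat ?size_map ?size_iota //.
by rewrite -val_enum_ord -map_comp.
Qed.

Lemma size_phase_tail_word i m : size (phase_tail i m) = (m - (3 * i).+2)%N.
Proof. by rewrite size_drop size_mkseq. Qed.

Lemma phase_tail_cat i j : phase_tail i (phase_start i + j) =
  phase_tail i (phase_start i) ++ mkseq (fun m => omega (phase_start i + m)) j.
Proof.
rewrite /phase_tail mkseqD drop_cat size_mkseq.
have := phase_start_ge i; rewrite leq_eqVlt => /orP[/eqP <-|-> //].
by rewrite ltnn subnn drop0 drop_oversize // size_mkseq.
Qed.

Definition phase_uniq i := uniq [seq tailw e.1 |
   e <- trace (step i) (phase_word i) (phase_tail i (phase_start i))].

Local Notation sel i := (select (phase_word i) (phase_tail i (phase_start i))).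
Local Notation phase_allowed i u :=
  (allowed (step i) (phase_word i) (sel i).1 (sel i).2 u).

Lemma phase_start_le : {homo phase_start : i j / (i <= j)%N}.
Proof.
exact: (homo_leq leqnn leq_trans (fun i => ltnW (phase_start_lt i))).
Qed.

Lemma phase_eq i m : (phase_start i <= m < phase_start i.+1)%N -> phase m = i.
Proof.
move=> /andP[im mi]; have [h1 h2] := phaseP m.
have m2 : (2 <= m)%N by have := phase_start_ge i; lia.
apply/eqP; rewrite eqn_leq; apply/andP; split; rewrite leqNgt; apply/negP => lt.
  by have := phase_start_le lt; have := h2 m2; lia.
by have := phase_start_le lt; lia.
Qed.

Lemma ruleE i m : (phase_start i <= m < phase_start i.+1)%N ->
  let A := phase_allowed i (phase_tail i m) in
  rule (w m) = if A == finset.set0 then finset.setT else A.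
Proof.
move=> im; have /andP[im1 _] := im; rewrite /rule size_mkseq (phase_eq im).
have iN : ((3 * i).+2 <= m)%N := leq_trans (phase_start_ge i) im1.
have -> : (m < 2)%N = false by apply/negbTE; rewrite -leqNgt; lia.
have -> : [tuple nth c0 (w m) j | j < (3 * i).+2] = phase_word i.
  apply/eq_from_tnth => j; rewrite !tnth_mktuple nth_mkseq //.
  exact: leq_trans (ltn_ord j) iN.
have -> : take (phase_start i) (w m) = w (phase_start i).
  by rewrite -(subnKC im1) mkseqD take_size_cat ?size_mkseq.
by [].
Qed.

Section OnePhase.
Variable i : nat.
Hypothesis in_range : (phase_start i <= n)%N.
Hypothesis uniq_i : phase_uniq i.
Local Notation omega' := (fun m => omega (phase_start i + m)).
Local Notation tail0 := (phase_tail i (phase_start i)).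

Lemma phase_select :
  [/\ forall p, p != phase_word i ->
        (p, (sel i).1 p) \notin trace (step i) (phase_word i) tail0,
      trap_free (step i) (phase_word i) (sel i).1 (sel i).2 &
      exists2 pen, penalty_bound (phase_word i) tail0 (sel i).2 pen &
      \sum_v pen v <= phase_rate R k * (phase_loss R k * (k ^ (3 * i))%N%:R + C)].
Proof.
by apply: selectP uniq_i _; rewrite size_phase_tail_word size_phase_tail.
Qed.

Lemma phase_run j : (phase_start i + j <= n)%N ->
  (phase_start i + j <= phase_start i.+1)%N ->
  forall l, (l < j)%N ->
    omega' l \in phase_allowed i (tail0 ++ mkseq omega' l) /\
    rule (w (phase_start i + l)) = phase_allowed i (tail0 ++ mkseq omega' l).
Proof.
have [tree_unused tf _] := phase_select.
elim: j => // j IH jn ji.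
have [jn' ji'] : (phase_start i + j <= n)%N /\ (phase_start i + j <= phase_start i.+1)%N.
  by split; lia.
move: (IH jn' ji') => {}IH l; rewrite ltnS leq_eqVlt => /orP[/eqP ->|]; last exact: IH.
have jr : (phase_start i <= phase_start i + j < phase_start i.+1)%N by lia.
have tour : tour_invariant (step i) (phase_word i) tail0 (sel i).1 (sel i).2
    (tail0 ++ mkseq omega' j).
  apply: (@tour_prefix _ _ _ _ _ _ _ _ _ omega' j) => //.
    exact: tails_uniq_trace uniq_i.
  by move=> m /IH[].
have := allowed_neq0 (@db_indegree _ _) tf tour.
rewrite size_cat size_mkseq size_phase_tail_word card_tuple => /(_ _)/negbTE alln0.
have rE := ruleE jr; rewrite phase_tail_cat /= alln0 in rE; last first.
  rewrite -expnSr; move: ji; rewrite phase_startS; have := phase_start_ge i; lia.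
by rewrite -rE; split=> //; apply: omega_rule; lia.
Qed.

Lemma phase_entropy j : (phase_start i + j <= n)%N ->
  (phase_start i + j <= phase_start i.+1)%N ->
  phase_rate R k * (j%:R - (phase_loss R k * (k ^ (3 * i))%N%:R + C)) <=
    \sum_(phase_start i <= m < phase_start i + j) ln #|rule (w m)|%:R.
Proof.
move=> jn ji; have run := phase_run jn ji.
have [tree_unused tf [pen hpen spen]] := phase_select.
rewrite mulrBr; apply: le_trans (lerB (lexx _) spen) _.
rewrite addnC -[X in index_iota X]add0n big_addn addnK.
under eq_big_nat => m /andP[_ mj] do rewrite addnC (run m mj).2.
apply: (tour_entropy tree_unused) hpen.
- exact: tails_uniq_trace uniq_i.
- by move=> m /run[].
Qed.

Lemma next_phase_factors : (phase_start i.+1 <= n)%N ->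
  {in [pred j | j < k ^ (3 * i.+1)]%N &,
   injective (factor (3 * i.+1) (w (phase_start i.+1)))}.
Proof.
move=> ni; have ji := subnKC (ltnW (phase_start_lt i)).
set j := (_ - _)%N in ji; have [tree_unused tf _] := phase_select.
have run : forall l, (l < j)%N -> omega' l \in phase_allowed i (tail0 ++ mkseq omega' l).
  by move=> l lj; have [] := phase_run _ _ lj; rewrite ?ji.
have [uu _ _] := tour_prefix tree_unused (tails_uniq_trace uniq_i) run (leqnn _).
move: uu; rewrite -phase_tail_cat ji.
rewrite -(map_inj_uniq (f := fun e => rcons (val e.1) e.2)); last first.
  by move=> [v c] [v' c'] /= /rcons_inj[/val_inj -> ->].
rewrite trace_factors phase_wordK; last first.
  by have := phase_start_ge i; have := phase_start_lt i; lia.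
rewrite size_phase_tail_word phase_startS addnK -[(3 * i).+3]/(3 + 3 * i)%N -mulnS.
move=> /uniq_map_inj_in inj x y xk yk; apply: inj; rewrite mem_iota //.
Qed.

End OnePhase.

(** After phase [i] the factors of length [3 (i + 1)] are distinct. The tails of the next graph are
    one letter longer, so they are distinct already by their prefixes. *)
Lemma phase_uniq_all i : (phase_start i <= n)%N -> phase_uniq i.
Proof.
elim: i => [_|i IH ni].
  rewrite /phase_uniq; suff -> : phase_tail 0 (phase_start 0) = [::] by [].
  by apply/size0nil; rewrite size_phase_tail_word.
have ni' : (phase_start i <= n)%N := leq_trans (ltnW (phase_start_lt i)) ni.
have inj := next_phase_factors ni' (IH ni') ni.
rewrite /phase_uniq -(map_inj_uniq val_inj) -map_comp.
rewrite (trace_tails (phase_word i.+1)) phase_wordK ?phase_start_ge //.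
rewrite map_inj_in_uniq ?iota_uniq // => x y; rewrite !mem_iota !add0n /=.
rewrite size_phase_tail_word => xl yl e.
have lt z : (z < phase_start i.+1 - (3 * i.+1).+2)%N -> (z.+1 < k ^ (3 * i.+1))%N.
  by rewrite /phase_start; lia.
apply: succn_inj; apply: inj; rewrite ?inE ?lt //.
have := congr1 (take (3 * i.+1)) e; by rewrite /factor !take_takel ?leqnSn.
Qed.

End GlobalRule.

(** * Entropy per letter at every scale *)

Section EntropyRate.
Variable R : realType.

(* At the start of the phase of order [n] the entropy is about
   [phase_gain k * k ^ n]; the entropy per letter is least
   [phase_loss k * k ^ n] letters later. *)
Definition phase_gain (k : nat) : R :=
  phase_rate R k * ((k ^ 3)%N%:R - 1 - phase_loss R k) / ((k ^ 3)%N%:R - 1).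

Definition entropy_rate (k : nat) : R := phase_gain k / (1 + phase_loss R k).

Lemma phase_loss_bounds k : (1 < k)%N -> 0 <= phase_loss R k < (k ^ 3)%N%:R - 1.
Proof.
move=> k1; rewrite /phase_loss; case: eqP => [->|/eqP k2].
  by rewrite natrX; apply/andP; split; lra.
have : (3 ^ 3 <= k ^ 3)%N by rewrite leq_exp2r; lia.
rewrite -(ler_nat R) natrX => k3.
by case: ifP => _; apply/andP; split; lra.
Qed.

Lemma entropy_rate_bounds k : (1 < k)%N ->
  [/\ 0 <= entropy_rate k, entropy_rate k <= phase_rate R k &
      0 <= phase_gain k].
Proof.
move=> k1; have /andP[t0 t1] := phase_loss_bounds k1; have c0 := phase_rate_ge0 R k.
have g0 : 0 <= phase_gain k by rewrite /phase_gain divr_ge0 ?mulr_ge0 //; lra.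
split=> //; first by rewrite divr_ge0 //; lra.
rewrite ler_pdivrMr; last by lra.
rewrite ler_pdivrMr; last by lra.
rewrite -!mulrA ler_wpM2l //; nra.
Qed.

Variables (B : finType) (c0 : B).
Hypothesis B_gt1 : (1 < #|B|)%N.
Local Notation k := #|B|.
Local Notation word i := ((3 * i).+2.-tuple B).
Local Notation step i := (@dbstep B (3 * i).+1).
Variables (C : R) (select : forall i, word i -> seq B -> (word i -> B) * {set word i}).
Hypothesis C_ge0 : 0 <= C.
Hypothesis selectP : forall i (a : word i) u0,
  uniq [seq tailw e.1 | e <- trace (step i) a u0] -> (size u0 <= k ^ (3 * i))%N ->
  let t := (select a u0).1 in let X := (select a u0).2 in
  [/\ forall p, p != a -> (p, t p) \notin trace (step i) a u0,
      trap_free (step i) a t X &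
      exists2 pen, penalty_bound a u0 X pen &
      \sum_v pen v <= phase_rate R k * (phase_loss R k * (k ^ (3 * i))%N%:R + C)].
Local Notation rule := (rule c0 select).
Local Notation start := (phase_start B).
Local Notation c := (phase_rate R k).
Local Notation theta := (phase_loss R k).
Local Notation h := (phase_gain k).
Local Notation gamma := (entropy_rate k).
Local Notation D i := ((k ^ (3 * i))%N%:R : R).

Section Omega.
Variables (omega : nat -> B) (n : nat).
Hypothesis omega_rule : forall m, (m < n)%N -> omega m \in rule (mkseq omega m).
Local Notation E p m := (\sum_(p <= j < m) ln #|rule (mkseq omega j)|%:R : R).

Lemma rule_entropy_ge0 p m : 0 <= E p m.
Proof.
apply: sumr_ge0 => j _; rewrite ln_ge0 // ler1n card_gt0; exact: rule_neq0.
Qed.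

Let entropy_in_phase := phase_entropy B_gt1 selectP omega_rule.

(** With [K] for [k ^ 3], a phase adds at least [c ((K - 1 - theta) D i - C)], and [h] is the
    solution of [h (K - 1) = c (K - 1 - theta)]. The constant [C] is lost once per phase. *)
Lemma entropy_at_phase_start i : (start i <= n)%N ->
  h * D i - i%:R * (c * C) - h <= E 0 (start i).
Proof.
have /andP[th0 th1] := phase_loss_bounds B_gt1.
have c_ge0 := phase_rate_ge0 R k.
elim: i => [_|i IH ni].
  by rewrite muln0 expn0 mulr1 mul0r subr0 subrr rule_entropy_ge0.
have ni' : (start i <= n)%N := leq_trans (ltnW (phase_start_lt B_gt1 i)) ni.
have ji := subnKC (ltnW (phase_start_lt B_gt1 i)).
have := entropy_in_phase ni' (phase_uniq_all B_gt1 selectP omega_rule ni').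
move=> /(_ (start i.+1 - start i)%N); rewrite ji => /(_ ni (leqnn _)) ent.
have cat : E 0 (start i.+1) = E 0 (start i) + E (start i) (start i.+1).
  by rewrite -big_cat_nat // ltnW // phase_start_lt.
rewrite cat; have {}IH := IH ni'.
have DS : D i.+1 = (k ^ 3)%N%:R * D i by rewrite mulnS expnD natrM.
have size_phase : ((k ^ 3)%N%:R - 1) * D i <= (start i.+1 - start i)%N%:R.
  rewrite mulrBl mul1r -natrM -expnD lerBlDr -natrD ler_nat.
  rewrite phase_startS -[(3 * i).+3]/(3 + 3 * i)%N.
  have := size_phase_tail B_gt1 i; lia.
have gainE : h * (((k ^ 3)%N%:R - 1) * D i) = c * (((k ^ 3)%N%:R - 1 - theta) * D i).
  rewrite /phase_gain; field; lra.
have : c * (((k ^ 3)%N%:R - 1) * D i - (theta * D i + C)) <= E (start i) (start i.+1).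
  by apply: le_trans ent; rewrite ler_wpM2l // lerD2r.
rewrite DS -natr1; move: gainE IH; lra.
Qed.

Lemma entropy_up_to_phase :
  gamma * n%:R - (3 * gamma + c * C + h) * (phase B n).+1%:R <= E 0 n.
Proof.
have [g0 gc h0] := entropy_rate_bounds B_gt1.
have /andP[th0 th1] := phase_loss_bounds B_gt1.
have c_ge0 := phase_rate_ge0 R k; have cC0 : 0 <= c * C by rewrite mulr_ge0.
have [n2|n2] := ltnP n 2.
  apply: le_trans (rule_entropy_ge0 0 n); rewrite subr_le0.
  apply: (@le_trans _ _ ((3 * gamma + c * C + h) * 1)); last first.
    by rewrite ler_wpM2l ?ler1n //; lra.
  have : n%:R <= 2 :> R by rewrite (ler_nat _ _ 2) ltnW.
  nra.
have [n_lt /(_ n2) le_n] := phaseP B_gt1 n; set i := phase B n in n_lt le_n *.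
have nE := subnKC le_n; set j := (n - start i)%N in nE.
have := entropy_in_phase le_n (phase_uniq_all B_gt1 selectP omega_rule le_n).
move=> /(_ j); rewrite nE => /(_ (leqnn _) (ltnW n_lt)) ent.
have E0 := entropy_at_phase_start le_n; have Ej := rule_entropy_ge0 (start i) n.
have -> : E 0 n = E 0 (start i) + E (start i) n by rewrite -big_cat_nat.
have start_le : (start i)%:R <= D i + 3 * i%:R + 2.
  have : (start i <= k ^ (3 * i) + 3 * i + 2)%N.
    by rewrite -addnA addn2 addnC -leq_subLR; exact: size_phase_tail.
  by rewrite -(ler_nat R) (natrD _ _ 2) (natrD _ (_ ^ _)%N) (natrM _ 3).
have nR : n%:R = (start i)%:R + j%:R :> R by rewrite -natrD nE.
have gh : gamma * (1 + theta) = h by rewrite /entropy_rate divfK //; lra.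
have D0 : 0 <= D i by [].
have i0 : 0 <= i%:R :> R by [].
(* For [j <= theta * D i] the entropy at the phase start suffices, as [h = gamma (1 + theta)];
   beyond, entropy grows at slope [c >= gamma]. *)
have key : gamma * (D i + j%:R) <= h * D i + c * C + E (start i) n.
  have [jD|Dj] := leP j%:R (theta * D i).
    rewrite (@le_trans _ _ (gamma * (D i + theta * D i))) ?ler_wpM2l ?lerD2l //.
    by rewrite -gh; lra.
  have : gamma * (j%:R - theta * D i) <= c * (j%:R - theta * D i).
    by rewrite ler_wpM2r // subr_ge0 ltW.
  by rewrite -gh; lra.
have : gamma * n%:R <= gamma * (D i + j%:R) + gamma * (3 * i%:R + 2).
  by rewrite -mulrDr ler_wpM2l // nR; lra.
have hi : 0 <= h * i%:R by rewrite mulr_ge0.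
have gi : 0 <= gamma * i%:R by rewrite mulr_ge0.
rewrite -natr1; move: E0 key; lra.
Qed.

End Omega.

(** The error is linear in the number [i] of phases, hence logarithmic in the length:
    [4 ^ i <= n + 1], and [C' 2 ^ i] is absorbed into [eps 4 ^ i] plus a constant by completing a
    square. *)
Lemma rule_entropy_lower (eps : R) : 0 < eps -> exists K : R,
  forall (omega : nat -> B) n,
  (forall m, (m < n)%N -> omega m \in rule (mkseq omega m)) ->
  (gamma - eps) * n%:R - K <= \sum_(0 <= j < n) ln #|rule (mkseq omega j)|%:R.
Proof.
move=> eps0; pose C' := 3 * gamma + c * C + h.
exists (eps + C' ^+ 2 / (4 * eps)) => omega n hom.
apply: le_trans (entropy_up_to_phase hom).
rewrite -/C'.
have [g0 gc h0] := entropy_rate_bounds B_gt1.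
have C'0 : 0 <= C' by have := mulr_ge0 (phase_rate_ge0 R k) C_ge0; rewrite /C'; lra.
set i := phase B n.
have two_i : ((i.+1)%:R : R) <= 2 ^+ i by rewrite -natrX ler_nat; exact: ltn_expl.
have four_i : (2 ^+ i) ^+ 2 <= n%:R + 1 :> R.
  rewrite -exprM -natrX natr1 ler_nat /i.
  have [n2|n2] := ltnP n 2.
    by rewrite phase_small // mul0n expn0.
  have [_ /(_ n2)] := phaseP B_gt1 n; case: (phase B n) => [|j]; first by rewrite mul0n expn0.
  have : (2 ^ (3 * j.+1) <= k ^ (3 * j.+1))%N by rewrite leq_exp2r // muln_gt0.
  have : (2 ^ (j.+1 * 2) <= 2 ^ (3 * j.+1))%N by rewrite leq_exp2l //; lia.
  rewrite /phase_start; lia.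
have : C' * i.+1%:R <= eps * (2 ^+ i) ^+ 2 + C' ^+ 2 / (4 * eps).
  apply: (@le_trans _ _ (C' * 2 ^+ i)); first by rewrite ler_wpM2l.
  set x := 2 ^+ i; rewrite -subr_ge0.
  rewrite (_ : _ - _ = (2 * eps * x - C') ^+ 2 / (4 * eps)); last first.
    by field; rewrite gt_eqF.
  by rewrite divr_ge0 ?sqr_ge0 // mulr_ge0 // ltW.
have : eps * (2 ^+ i) ^+ 2 <= eps * (n%:R + 1) by rewrite ler_wpM2l // ltW.
lra.
Qed.

End EntropyRate.

Lemma alpha_le_entropy_rate (R : realType) (k : nat) : (1 < k)%N ->
  alpha R k * ln k%:R <= entropy_rate R k.
Proof.
move=> k1; have l2 : 0 < ln 2 :> R by rewrite ln_gt0 // ltr1n.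
rewrite /entropy_rate /phase_gain /phase_rate /phase_loss /alpha.
case: eqP => [->|/eqP k2].
  rewrite -[(2 ^ 3)%N]/8%N.
  (* The target [1 / 49] is [14 / 686]; the ideal loss 5, without cycles to cut, would give
     [1 / 42]. *)
  rewrite [leRHS](_ : _ = 15 / 686 * ln 2); last by field.
  lra.
case: eqP => [->|/eqP k3].
  have l3 : ln 2 < ln 3 :> R by rewrite ltr_ln ?posrE // ltr_nat.
  have l4 : ln 4 = 2 * ln 2 :> R.
    have -> : 4 = 2 * 2 :> R by lra.
    by rewrite lnM ?posrE //; lra.
  have pos : 0 < 9 * (ln 3 / ln 4) - 1 :> R.
    by rewrite subr_gt0 mulrA ltr_pdivlMr ?l4; lra.
  rewrite mulrC ler_pdivrMr; last by rewrite mulr_gt0.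
  have -> : 9 * (ln 3 / ln 4) = 9 / 2 * (ln 3 / ln 2) :> R.
    by rewrite l4; field; rewrite gt_eqF.
  have l32 : ln 3 = ln 3 / ln 2 * ln 2 :> R by rewrite divfK ?gt_eqF.
  have q1 : 1 < ln 3 / ln 2 :> R by rewrite ltr_pdivlMr // mul1r.
  rewrite {1}l32 -[(3 ^ 3)%N]/27%N; move: (ln 3 / ln 2) q1 => x x1.
  (* The rate for [k = 3] is [4 * ln 2 / 39]; with [x = ln 3 / ln 2] the claim is [32 <= 105 x]. *)
  rewrite [leRHS](_ : _ = (144 * x - 32) / 39 * ln 2); last by field.
  by rewrite ler_wpM2r ?ltW //; lra.
have c0 : 0 < k%:R :> R by rewrite ltr0n; lia.
have lk : 0 < ln k%:R :> R by rewrite ln_gt0 // ltr1n.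
have k3' : 1 < (k ^ 3)%N%:R :> R by rewrite ltr1n; have := ltn_expl 3 k1; lia.
rewrite !subr0 addr0 divr1 mulfK; last by rewrite gt_eqF // subr_gt0.
by rewrite invfM mulrA divfK ?gt_eqF.
Qed.

(** * Hausdorff dimension of sets of expansions *)

Section TreeMass.
Variables (R : realType) (B : finType) (f : seq B -> R).
Hypothesis f_ge0 : forall s, 0 <= f s.
Hypothesis f_split : forall s, f s = \sum_c f (rcons s c).
Hypothesis f_nil : f [::] = 1.

(* The mass of the intersection of the cylinders of [v] and [w]. *)
Definition cylinder_meet (v w : seq B) : R :=
  if (size w <= size v)%N then if take (size w) v == w then f v else 0
  else if take (size v) w == v then f w else 0.

Lemma cylinder_meet_ge0 v w : 0 <= cylinder_meet v w.
Proof. by rewrite /cylinder_meet; do 2![case: ifP => _]. Qed.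

Lemma cylinder_meet_split v w :
  cylinder_meet v w = \sum_c cylinder_meet (rcons v c) w.
Proof.
rewrite {1}/cylinder_meet; case: leqP => [wv|vw].
  under eq_bigr => c _ do
    rewrite /cylinder_meet size_rcons leqW // -cats1 takel_cat // cats1.
  by case: ifP => _; [exact: f_split | rewrite big1].
have {1}-> : (\sum_c cylinder_meet (rcons v c) w =
    \sum_c if take (size v).+1 w == rcons v c then f w else 0).
  apply: eq_bigr => c _; rewrite /cylinder_meet size_rcons.
  case: leqP => // wv; have wE : size w = (size v).+1 by apply/eqP; rewrite eqn_leq wv vw.
  rewrite !take_oversize ?size_rcons ?wE // eq_sym.
  by case: eqP => // ->.
have [c0 _] : exists c0 : B, true by case: w vw => // c0 *; exists c0.
rewrite (take_nth c0) // -big_mkcond /=.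
have [tv|tv] := eqVneq; last first.
  by rewrite big_pred0 // => c; rewrite eqseq_rcons (negPf tv).
rewrite (big_pred1 (nth c0 w (size v))) // => c.
by rewrite tv eqseq_rcons eqxx /= eq_sym.
Qed.

Variable W : nat -> seq (seq B).
Local Notation nu v := (\sum_(0 <= i <oo) (\sum_(w <- W i) cylinder_meet v w)%:E)%E.

Let term_ge0 v i : (0 <= (\sum_(w <- W i) cylinder_meet v w)%:E)%E.
Proof. by rewrite lee_fin sumr_ge0 // => w _; exact: cylinder_meet_ge0. Qed.

Lemma nu_split v : nu v = (\sum_c nu (rcons v c))%E.
Proof.
rewrite -nneseries_sum => [|c i _]; last exact: term_ge0.
apply: eq_eseriesr => i _; rewrite sumEFin; congr EFin.
by rewrite exchange_big /=; apply: eq_bigr => w _; exact: cylinder_meet_split.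
Qed.

(** Both sides are sums over the children. As [nu] sums the whole infinite family, the branch need
    not be rechecked against finite subfamilies, and no compactness enters. *)
Lemma nu_child v : (nu v < (f v)%:E)%E ->
  exists c, (nu (rcons v c) < (f (rcons v c))%:E)%E.
Proof.
move=> nuv; apply: contrapT => /forallNP nex.
move: nuv; rewrite nu_split f_split -sumEFin ltNge; apply/negP/negPn.
by apply: lee_sum => c _; rewrite leNgt; apply/negP.
Qed.

(* Follow a child [c] for which the cylinders of [W] meet that of [rcons v c] in
   less than its mass. *)
Lemma branch_avoiding : (\sum_(0 <= i <oo) (\sum_(w <- W i) f w)%:E < 1)%E ->
  exists2 omega : nat -> B, forall n, 0 < f (mkseq omega n) &
    forall i w, w \in W i -> mkseq omega (size w) <> w.
Proof.
move=> small; have nil_ok : (nu [::] < (f [::])%:E)%E.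
  rewrite f_nil; apply: le_lt_trans small; apply: lee_nneseries => // i _.
  rewrite lee_fin; apply: ler_sum => w _; rewrite /cylinder_meet /=.
  by case: w => [|c w] //=; case: ifP.
have [c0 _] : exists c0 : B, true.
  have := f_split [::]; rewrite f_nil => fs.
  have [//|nB] := pselect (exists c0 : B, true).
  move: fs; rewrite big1 => [/eqP|c]; first by rewrite oner_eq0.
  by case: nB; exists c.
have /choice[next nextP] : forall v, exists c, (nu v < (f v)%:E)%E ->
    (nu (rcons v c) < (f (rcons v c))%:E)%E.
  move=> v; have [/nu_child[c ?]|?] := pselect (nu v < (f v)%:E)%E; first by exists c.
  by exists c0.
pose br n := iter n (fun v => rcons v (next v)) [::].
pose omega n := next (br n).
have brE n : mkseq omega n = br n by elim: n => // n IH; rewrite mkseqS IH.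
have br_ok n : (nu (br n) < (f (br n))%:E)%E by elim: n => // n IH; exact: nextP.
exists omega => [n|i w wi hit].
  rewrite brE -lte_fin; apply: le_lt_trans (br_ok n).
  by apply: nneseries_ge0 => j _ _; exact: term_ge0.
(* On reaching [w] itself, its own term makes [nu w] at least [f w]. *)
have := br_ok (size w); rewrite -brE hit ltNge => /negP; apply.
apply: le_trans (nneseries_lim_ge i.+1 _) => [|j _ _]; last exact: term_ge0.
rewrite big_nat_recr //= -[leLHS]add0e; apply: leeD.
  by apply: sume_ge0 => j _; exact: term_ge0.
rewrite lee_fin (big_rem w) //= -[leLHS]addr0 lerD //.
  by rewrite /cylinder_meet leqnn take_size eqxx.
by apply: sumr_ge0 => u _; exact: cylinder_meet_ge0.
Qed.

End TreeMass.

Section Expansions.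
Variables (R : realType) (b : nat).
Hypothesis b_gt1 : (1 < b)%N.
Implicit Types omega : nat -> 'I_b.

Fixpoint digits_num omega m : nat :=
  if m is m'.+1 then (digits_num omega m' * b + omega m')%N else 0%N.

Local Notation digit_series omega :=
  (series (fun i => (omega i)%:R / b%:R ^+ i.+1 : R)).

Let b_gt0 m : 0 < b%:R ^+ m :> R. Proof. by rewrite exprn_gt0 // ltr0n ltnW. Qed.

Lemma digit_seriesE omega m :
  digit_series omega m = (digits_num omega m)%:R / b%:R ^+ m.
Proof.
elim: m => [|m IH]; first by rewrite /series /= big_geq // mul0r.
rewrite /series /= big_nat_recr //= -[X in X + _]/(digit_series omega m) IH.
have bn0 : b%:R != 0 :> R by rewrite pnatr_eq0 -lt0n ltnW.
by rewrite natrD natrM exprSr; field; rewrite ?expf_neq0 ?bn0.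
Qed.

Lemma digit_series_homo omega :
  {homo digit_series omega : m n / (m <= n)%N >-> m <= n}.
Proof.
move=> m n mn; rewrite /series /= (big_cat_nat (leq0n m) mn) /= lerDl.
by apply: sumr_ge0 => i _; rewrite divr_ge0 // exprn_ge0.
Qed.

Lemma digit_series_le omega m n : (m <= n)%N ->
  digit_series omega n <= (digits_num omega m).+1%:R / b%:R ^+ m.
Proof.
move=> mn; rewrite digit_seriesE ler_pdivrMr // mulrAC ler_pdivlMr //.
have h j : ((digits_num omega (m + j)).+1 <= (digits_num omega m).+1 * b ^ j)%N.
  elim: j => [|j IH]; first by rewrite addn0 muln1.
  rewrite addnS /= expnSr mulnA (leq_trans _ (leq_mul IH (leqnn b))) //.
  by rewrite mulSn addnC ltn_add2r.
rewrite -(subnKC mn) -!natrX -!natrM ler_nat expnD mulnA mulnAC leq_mul2r.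
by rewrite (leq_trans (leqnSn _) (h _)) orbT.
Qed.

Lemma expansion_bounds omega (x : R) m : is_expansion omega x ->
  (digits_num omega m)%:R / b%:R ^+ m <= x <=
  (digits_num omega m).+1%:R / b%:R ^+ m.
Proof.
move=> wx; have cw : cvgn (digit_series omega) by apply/cvg_ex; exists x.
have xE : limn (digit_series omega) = x by apply/cvg_lim.
rewrite -digit_seriesE -{1}xE -{1}xE nondecreasing_cvgn_le //=; last exact: digit_series_homo.
apply: limr_le => //; near=> n; apply: digit_series_le; near: n.
exact: nbhs_infty_ge.
Unshelve. all: by end_near. Qed.

Lemma expansion_exists omega : exists2 x : R, is_expansion omega x & 0 <= x <= 1.
Proof.
have cw : cvgn (digit_series omega).
  apply: nondecreasing_is_cvgn; first exact: digit_series_homo.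
  exists ((digits_num omega 0).+1%:R / b%:R ^+ 0) => _ [n _ <-].
  exact: digit_series_le.
exists (limn (digit_series omega)) => //.
have := @expansion_bounds omega _ 0 cw.
by rewrite expr0 /= mul0r divr1.
Qed.

Lemma digits_num_inj omega omega' m :
  digits_num omega m = digits_num omega' m ->
  forall i, (i < m)%N -> omega i = omega' i.
Proof.
elim: m => //= m IH e i; rewrite ltnS leq_eqVlt.
have e2 : omega m = omega' m.
  apply/val_inj; have := congr1 (modn^~ b) e.
  by rewrite /= !modnMDl !modn_small.
case/orP=> [/eqP -> //|]; apply: IH.
move: e; rewrite e2 => /eqP; rewrite eqn_add2r eqn_pmul2r; last exact: ltnW.
by move=> /eqP.
Qed.

Lemma digits_num_near omega omega' (x x' : R) m : is_expansion omega x ->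
  is_expansion omega' x' -> `|x - x'| <= (b%:R ^+ m)^-1 ->
  (digits_num omega m <= digits_num omega' m + 2)%N.
Proof.
move=> /(@expansion_bounds _ _ m)/andP[h _] /(@expansion_bounds _ _ m)/andP[_ h'].
rewrite ler_distl => /andP[_ xx'].
have : (digits_num omega m)%:R / b%:R ^+ m <= ((digits_num omega' m).+1.+1)%:R / b%:R ^+ m :> R.
  rewrite -[X in _ <= X / _]natr1 mulrDl mul1r.
  by apply: le_trans h (le_trans xx' _); rewrite lerD2r.
by rewrite ler_pM2r ?invr_gt0 // ler_nat addn2.
Qed.

End Expansions.

Section HausdorffBasics.
Variable R : realType.
Implicit Types (s : R) (U E : set R).

Lemma diam_ge U x y : U x -> U y -> (`|x - y|%:E <= diam U)%E.
Proof. by move=> Ux Uy; apply: ereal_sup_ubound; exists x, y. Qed.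

Lemma diam_ge0 U x : U x -> (0 <= diam U)%E.
Proof. by move=> Ux; apply: le_trans (diam_ge Ux Ux). Qed.

Lemma diam_pow_ge0 s U : (0 <= diam_pow s U)%E.
Proof. by rewrite /diam_pow; case: ifP => // _; exact: poweR_ge0. Qed.

Lemma hausdorff_measure0_cover s E (eps eta : R) :
  hausdorff_measure s E = 0%E -> 0 < eps -> 0 < eta ->
  exists U : nat -> set R, [/\ (E `<=` \bigcup_i U i)%classic,
    forall i, (diam (U i) <= eps%:E)%E &
    (\sum_(0 <= i <oo) diam_pow s (U i) < eta%:E)%E].
Proof.
move=> h0 eps0 eta0.
have : (hausdorff_premeasure s eps E < eta%:E)%E.
  apply: (@le_lt_trans _ _ (hausdorff_measure s E)); last by rewrite h0 lte_fin.
  by apply: ereal_sup_ubound; exists eps.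
by move=> /ereal_inf_lt[_ [U [EU dU] <-] lt]; exists U.
Qed.

Lemma hausdorff_dim_ge E (d : R) :
  (forall s, 0 <= s -> s < d -> hausdorff_measure s E <> 0%E) ->
  (d%:E <= hausdorff_dim E)%E.
Proof.
move=> h; apply: le_ereal_inf_tmp => _ [s [s0 hs] <-]; rewrite lee_fin leNgt.
by apply/negP => /(h s s0).
Qed.

Lemma hausdorff_dim_le E (d : R) : 0 <= d ->
  (forall s, d < s -> hausdorff_measure s E = 0%E) ->
  (hausdorff_dim E <= d%:E)%E.
Proof.
move=> d0 h; apply/lee_addgt0Pr => e e0; apply: ereal_inf_lbound.
exists (d + e) => //; split; first by rewrite addr_ge0 // ltW.
by apply: h; rewrite ltrDl.
Qed.

End HausdorffBasics.

(** * The mass distribution principle *)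

Section MassDistribution.
Variables (R : realType) (b : nat).
Hypothesis b_gt1 : (1 < b)%N.

Lemma small_scale (x : R) : 0 < x -> exists m, (b%:R ^+ m)^-1 < x.
Proof.
move=> x0; exists (Num.truncn x^-1).+1; set m := _.+1.
rewrite -[ltRHS]invrK ltf_pV2 ?posrE ?invr_gt0 ?exprn_gt0 ?ltr0n ?(ltnW b_gt1) //.
have xm : x^-1 < m%:R by apply: truncnS_gt.
apply: lt_trans xm _; rewrite -natrX ltr_nat; exact: ltn_expl.
Qed.

(** The scale is the smallest [b ^- m] not below the diameter, hence within a factor [b] of it. For
    diameter 0 there is no such scale; [m] is then taken so large that [eta] absorbs the cost. *)
Lemma scale_choice (s s' K eta : R) (U : set R) (x0 : R) :
  0 < s -> 0 <= s' -> s' <= s -> 0 <= K -> 0 < eta -> U x0 -> (diam U <= 1)%E ->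
  exists m, (diam U <= ((b%:R ^+ m)^-1)%:E)%E /\
    ((K * ((b%:R ^+ m)^-1 `^ s))%:E <=
      (K * b%:R `^ s)%:E * diam_pow s' U + eta%:E)%E.
Proof.
move=> s0 s'0 s's K0 eta0 Ux0 dU1.
have Un0 : (U == set0) = false by apply/negbTE/set0P; exists x0.
have [d dE] : exists d, diam U = d%:E.
  by move: dU1 (diam_ge0 Ux0); case: (diam U) => // d _ _; exists d.
rewrite /diam_pow Un0 dE poweR_EFin.
move: dU1 (diam_ge0 Ux0); rewrite dE !lee_fin => d1 d0.
have bR : 0 < b%:R :> R by rewrite ltr0n ltnW.
have inv_pos m : 0 < (b%:R ^+ m)^-1 :> R by rewrite invr_gt0 exprn_gt0.
move: d0; rewrite le_eqVlt => /orP[/eqP <-|d0].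
  pose rho := (eta / (K + 1)) `^ s^-1; have rho0 : 0 < rho by rewrite powR_gt0 // divr_gt0 // ltr_wpDl.
  have [m mrho] := small_scale rho0; exists m; split; first by rewrite lee_fin ltW.
  apply: (@le_trans _ _ eta%:E); last first.
    by rewrite -[leLHS]add0e leeD2r // lee_fin !mulr_ge0 ?powR_ge0.
  rewrite lee_fin (@le_trans _ _ (K * (rho `^ s))) //.
    by rewrite ler_wpM2l // ge0_ler_powR ?nnegrE ?ltW.
  have K1 : 0 < K + 1 by rewrite ltr_wpDl.
  rewrite -powRrM mulVf ?gt_eqF // powRr1; last by rewrite divr_ge0 ?ltW.
  by rewrite mulrA ler_pdivrMr // mulrC ler_wpM2l ?lerDl // ltW.
have : exists m, (b%:R ^+ m)^-1 < d by exact: small_scale.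
case/ex_minnP => -[|m]; first by rewrite expr0 invr1 ltNge d1.
move=> md /(_ m) minm; exists m.
have dm : d <= (b%:R ^+ m)^-1 by rewrite leNgt; apply/negP => /minm; rewrite ltnn.
split=> //; rewrite -EFinM -EFinD lee_fin.
apply: (@le_trans _ _ (K * b%:R `^ s * d `^ s')); last by rewrite lerDl ltW.
rewrite -[leRHS]mulrA ler_wpM2l //.
have mb : (b%:R ^+ m)^-1 <= b%:R * d.
  by have := ltW md; rewrite exprS invfM -(ler_pM2l bR) mulrA mulfV ?mul1r ?gt_eqF.
apply: (@le_trans _ _ ((b%:R * d) `^ s)).
  by apply: ge0_ler_powR; rewrite ?nnegrE // ltW // mulr_gt0.
by rewrite (powRM _ (ltW bR) (ltW d0)) ler_wpM2l ?powR_ge0 // ger_powR // d0 d1.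
Qed.

Variables (B : finType) (phi : B -> 'I_b).
Hypothesis phi_inj : injective phi.

Lemma digits_num_ext (omega omega' : nat -> 'I_b) m :
  (forall i, (i < m)%N -> omega i = omega' i) ->
  digits_num omega m = digits_num omega' m.
Proof.
elim: m => //= m IH e; rewrite (e m) ?ltnSn // IH // => i im.
by apply: e; exact: ltnW.
Qed.

Variables (f : seq B -> R) (E : set R) (s K : R).
Hypothesis f_ge0 : forall w, 0 <= f w.
Hypothesis f_split : forall w, f w = \sum_c f (rcons w c).
Hypothesis f_nil : f [::] = 1.
Hypothesis s_gt0 : 0 < s.
Hypothesis f_le : forall w, f w <= K * (b%:R ^+ size w)^-1 `^ s.
Hypothesis f_E : forall omega : nat -> B, (forall n, 0 < f (mkseq omega n)) ->
  forall x, is_expansion (phi \o omega) x -> E x.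

(** The digit number determines the word, so a window of five integers contains at most five words;
    the shift by 2 avoids truncated subtraction. *)
Lemma mass_near (c0 : B) m n0 :
  \sum_(t : m.-tuple B |
    (n0 <= digits_num (fun j => phi (nth c0 t j)) m + 2 <= n0 + 4)%N) f t <=
  5 * K * (b%:R ^+ m)^-1 `^ s.
Proof.
pose num (t : m.-tuple B) := digits_num (fun j => phi (nth c0 t j)) m.
pose near := [set t | (n0 <= num t + 2 <= n0 + 4)%N].
have num_inj : injective num.
  move=> t t' e; apply/val_inj/(@eq_from_nth _ c0); rewrite ?size_tuple // => i im.
  exact/phi_inj/(digits_num_inj b_gt1 e im).
have card_near : (#|near| <= 5)%N.
  have h : {in near &, injective (fun t => inord (num t + 2 - n0) : 'I_5)}.
    move=> t t'; rewrite !inE => /andP[h1 h2] /andP[h1' h2'] /(congr1 val).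
    by rewrite /= !inordK; [move=> e; apply: num_inj; lia | lia | lia].
  by rewrite -(card_in_imset h) (leq_trans (max_card _)) ?card_ord.
have K0 : 0 <= K.
  have := f_le [::]; rewrite f_nil /= expr0 invr1 powR1 mulr1 => K1.
  exact: le_trans ler01 K1.
apply: (@le_trans _ _ (\sum_(t in near) K * (b%:R ^+ m)^-1 `^ s)).
  rewrite [leRHS](eq_bigl (fun t => (n0 <= num t + 2 <= n0 + 4)%N)); last by move=> t; rewrite inE.
  by apply: ler_sum => t _; apply: le_trans (f_le _) _; rewrite size_tuple.
rewrite sumr_const -mulrA -[leLHS]mulr_natl ler_wpM2r ?mulr_ge0 ?powR_ge0 //.
by rewrite (ler_nat _ _ 5).
Qed.

(** A cover of small weight becomes a countable family of words of total mass below 1; a branch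
    avoiding them spells a point of [E] outside the cover. *)
Lemma mass_distribution s' : 0 <= s' -> s' <= s -> hausdorff_measure s' E <> 0%E.
Proof.
move=> s'0 s's H0.
have K1 : 1 <= K by have := f_le [::]; rewrite f_nil /= expr0 invr1 powR1 mulr1.
have K0 : 0 <= K := le_trans ler01 K1.
pose L := 5 * K * b%:R `^ s.
have L0 : 0 <= L by rewrite /L !mulr_ge0 // powR_ge0.
(* This keeps the main terms below [1 / 2]; the errors [2^-1 / 2 ^ i.+1] add up to the other
   half. *)
have e0 : 0 < 1 / (2 * (L + 1)) by rewrite divr_gt0 // mulr_gt0 // ltr_wpDl.
have [U [EU dU sumU]] := hausdorff_measure0_cover H0 ltr01 e0.
have [c0 _] : exists c0 : B, true.
  have [//|nB] := pselect (exists c0 : B, true).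
  have := f_split [::]; rewrite f_nil big1 => [/eqP|c]; first by rewrite oner_eq0.
  by case: nB; exists c.
(* All words of one length whose digit number is within 2 of that of a chosen point of [U i]. *)
have pick i : exists W : seq (seq B),
    ((\sum_(w <- W) f w)%:E <= L%:E * diam_pow s' (U i) + (2^-1 / (2 ^ i.+1)%:R)%:E)%E /\
    forall omega x, is_expansion (phi \o omega) x -> U i x ->
      exists m, mkseq omega m \in W.
  have [[x0 [om0 [ex0 Ux0]]]|none] := pselect (exists x0 (om0 : nat -> B),
      is_expansion (phi \o om0) x0 /\ U i x0); last first.
    exists [::]; split; last by move=> om x ex Ux; case: none; exists x, om.
    by rewrite big_nil adde_ge0 ?mule_ge0 ?lee_fin // diam_pow_ge0.
  have eta0 : 0 < 2^-1 / (2 ^ i.+1)%:R :> R by rewrite divr_gt0 // ltr0n expn_gt0.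
  have K50 : 0 <= 5 * K by rewrite mulr_ge0.
  have [m [dm hm]] := scale_choice s_gt0 s'0 s's K50 eta0 Ux0 (dU i).
  pose n0 := digits_num (phi \o om0) m.
  exists [seq val t | t in [pred t : m.-tuple B |
    (n0 <= digits_num (fun j => phi (nth c0 t j)) m + 2 <= n0 + 4)%N]].
  split.
    apply: le_trans hm; rewrite lee_fin big_image /=.
    exact: mass_near.
  move=> om x ex Ux; exists m.
  have -> : mkseq om m = val [tuple om j | j < m] by rewrite /mkseq -val_enum_ord -map_comp.
  apply: map_f; rewrite mem_enum.
  have dist (y z : R) : U i y -> U i z -> `|y - z| <= (b%:R ^+ m)^-1.
    by move=> Uy Uz; rewrite -lee_fin (le_trans (diam_ge Uy Uz)).
  rewrite inE (@digits_num_ext _ (phi \o om)); last first.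
    move=> j jm; congr phi.
    by rewrite -(tnth_nth c0 _ (Ordinal jm)) tnth_mktuple.
  have := digits_num_near b_gt1 ex0 ex (dist _ _ Ux0 Ux).
  have := digits_num_near b_gt1 ex ex0 (dist _ _ Ux Ux0).
  by rewrite -/n0 => h1 h2; rewrite h2 -[4%N]/(2 + 2)%N addnA leq_add2r h1.
have /choice[W hW] := pick.
have [|om om_pos om_avoid] := branch_avoiding f_ge0 f_split f_nil (W := W).
  apply: (@le_lt_trans _ _ (\sum_(0 <= i <oo)
      (L%:E * diam_pow s' (U i) + (2^-1 / (2 ^ i.+1)%:R)%:E))%E).
    apply: lee_nneseries => [i _ _|i _]; first by rewrite lee_fin sumr_ge0.
    exact: (hW i).1.
  apply: le_lt_trans (epsilon_trick _ _ _) _; [|by []|].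
    by move=> i; rewrite mule_ge0 ?lee_fin // diam_pow_ge0.
  rewrite nneseriesZl; last by move=> i _; exact: diam_pow_ge0.
  have sum0 : (0 <= \sum_(0 <= i <oo) diam_pow s' (U i))%E.
    by apply: nneseries_ge0 => i _ _; exact: diam_pow_ge0.
  case: (\sum_(0 <= i <oo) diam_pow s' (U i))%E sumU sum0 => // r.
  rewrite lte_fin lee_fin -EFinM -EFinD lte_fin => r_lt r0.
  have : L * r < 2^-1.
    apply: (@le_lt_trans _ _ (L * (1 / (2 * (L + 1))))).
      by rewrite ler_wpM2l // ltW.
    rewrite mulrA mulr1 ltr_pdivrMr ?mulr_gt0 ?ltr_wpDl // mulrA mulVf ?mul1r //.
    by rewrite ltrDl.
  lra.
have [x ex _] := expansion_exists R b_gt1 (phi \o om).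
have [i _ Ux] := EU x (f_E om_pos ex).
have [m mW] := (hW i).2 om x ex Ux.
by have := om_avoid i _ mW; rewrite size_mkseq.
Qed.

End MassDistribution.

Lemma ler_sum_sub (R : numDomainType) (T : eqType) (F : T -> R) (s t : seq T) :
  (forall x, 0 <= F x) -> uniq s -> {subset s <= t} ->
  \sum_(x <- s) F x <= \sum_(x <- t) F x.
Proof.
move=> F0; elim: s t => [|x s IH] t /=; first by rewrite big_nil sumr_ge0.
move=> /andP[xs us] st; have xt : x \in t by apply: st; rewrite mem_head.
rewrite big_cons (big_rem x xt) /= lerD2l; apply: IH => // y ys.
have yt : y \in t by apply: st; rewrite inE ys orbT.
have /perm_mem/(_ y) := perm_to_rem xt.
by rewrite yt inE => /esym; case: eqP => // yx; rewrite yx (negPf xs) in ys.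
Qed.

Lemma geometric_sum_le (R : realFieldType) (r : R) N K : 0 <= r -> r < 1 ->
  \sum_(n <- iota N K) r ^+ n <= r ^+ N / (1 - r).
Proof.
move=> r0 r1; have r1' : 0 < 1 - r by rewrite subr_gt0.
elim: K N => [|K IH] N /=.
  by rewrite big_nil divr_ge0 ?exprn_ge0 // ltW.
rewrite big_cons (le_trans (lerD (lexx _) (IH _))) //.
rewrite ler_pdivlMr // mulrDl divfK ?gt_eqF // exprS.
by rewrite mulrBr mulr1 [r * _]mulrC subrK.
Qed.

(** * Covers by cylinders and null sets *)

Section Covering.
Variables (R : realType) (b : nat).
Hypothesis b_gt1 : (1 < b)%N.

Definition word_cylinder (w : seq 'I_b) : set R :=
  [set x | exists2 omega, is_expansion omega x & mkseq omega (size w) = w]%classic.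

Lemma diam_word_cylinder w :
  (diam (word_cylinder w) <= ((b%:R ^+ size w)^-1)%:E)%E.
Proof.
apply: ge_ereal_sup => _ [x [y [[om ex omw] [om' ex' om'w] ->]]].
rewrite lee_fin.
have numE : digits_num om (size w) = digits_num om' (size w).
  apply: digits_num_ext => i iw.
  have := congr1 (fun s => nth (om i) s i) (etrans omw (esym om'w)).
  by rewrite !nth_mkseq.
have := expansion_bounds b_gt1 (size w) ex; have := expansion_bounds b_gt1 (size w) ex'.
rewrite numE -natr1 mulrDl mul1r => /andP[h1 h2] /andP[h3 h4].
by rewrite ler_distl; apply/andP; split; lra.
Qed.

Lemma hausdorff_measure_ge0 (s : R) (E : set R) : (0 <= hausdorff_measure s E)%E.
Proof.
apply: (@le_trans _ _ (hausdorff_premeasure s 1 E)); last first.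
  by apply: ereal_sup_ubound; exists 1 => //; exact: ltr01.
apply: le_ereal_inf_tmp => _ [U _ <-].
by apply: nneseries_ge0 => i _ _; exact: diam_pow_ge0.
Qed.

(** The families [W n] with [n >= N] together cover [E], and their weight is a tail of a geometric
    series. *)
Lemma hausdorff_measure_cover0 (E : set R) (s C r : R) (l : nat -> nat)
    (W : nat -> seq (seq 'I_b)) : 0 < s -> 0 <= C -> 0 <= r -> r < 1 ->
  (forall n, (n <= l n)%N) ->
  (forall n w, w \in W n -> size w = l n) ->
  (forall n, (size (W n))%:R * (b%:R ^+ l n)^-1 `^ s <= C * r ^+ n) ->
  (forall N x, E x -> exists2 n, (N <= n)%N &
     exists2 omega, is_expansion omega x & mkseq omega (l n) \in W n) ->
  hausdorff_measure s E = 0%E.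
Proof.
move=> s0 C0 r0 r1 nl szW smallW coverE.
have r1' : 0 < 1 - r by rewrite subr_gt0.
apply/eqP; rewrite eq_le hausdorff_measure_ge0 andbT.
apply: ge_ereal_sup => _ [eps eps0 <-]; apply/lee_addgt0Pr => eta eta0.
rewrite add0e.
have [N [Neta Neps]] : exists N, C * (r ^+ N / (1 - r)) <= eta /\
    (b%:R ^+ N)^-1 <= eps :> R.
  have [M Meps] := small_scale b_gt1 eps0.
  have x0 : 0 < eta * (1 - r) / (C + 1) by rewrite divr_gt0 ?mulr_gt0 // ltr_wpDl.
  have : \forall n \near \oo%classic, r ^+ n < eta * (1 - r) / (C + 1).
    apply: cvgr_lt x0; apply: cvg_expr; rewrite ger0_norm //.
  move=> [M' _ hM']; exists (maxn M M'); split.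
    have := hM' (maxn M M') (leq_maxr _ _) => /ltW.
    rewrite ler_pdivlMr ?ltr_wpDl // => h.
    rewrite mulrA ler_pdivrMr // (le_trans _ h) // mulrC ler_wpM2l ?exprn_ge0 //.
    by rewrite lerDl.
  apply: le_trans (ltW Meps); rewrite lef_pV2 ?posrE ?exprn_gt0 ?ltr0n ?(ltnW b_gt1) //.
  by rewrite ler_weXn2l ?leq_maxl // ler1n ltnW.
(* Covers are sequences, so the pairs [(n, w)] are listed by their codes; other codes get the empty
   set, of weight 0. *)
pose good (p : nat * seq 'I_b) := (N <= p.1)%N && (p.2 \in W p.1).
pose U i := if @pickle_inv (nat * seq 'I_b)%type i is Some p then
              if good p then word_cylinder p.2 else set0 else set0.
pose g (p : nat * seq 'I_b) : R := if good p then (b%:R ^+ l p.1)^-1 `^ s else 0.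
have g0 p : 0 <= g p by rewrite /g; case: ifP => // _; exact: powR_ge0.
apply: (@le_trans _ _ (\sum_(0 <= i <oo) diam_pow s (U i))%E).
  apply: ereal_inf_lbound; exists U => //; split.
    move=> x /(coverE N)[n Nn [om ex omW]]; exists (pickle (n, mkseq om (l n))) => //.
    rewrite /U pickleK_inv /good /= Nn omW /=; exists om => //.
    by rewrite size_mkseq.
  move=> i; rewrite /U; case: pickle_inv => [p|]; last first.
    by apply: ge_ereal_sup => _ [x [y [[]]]].
  case: ifP => [/andP[Np pW]|_]; last by apply: ge_ereal_sup => _ [x [y [[]]]].
  apply: le_trans (diam_word_cylinder _) _; rewrite lee_fin (szW _ _ pW).
  apply: le_trans Neps; rewrite lef_pV2 ?posrE ?exprn_gt0 ?ltr0n ?(ltnW b_gt1) //.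
  by rewrite ler_weXn2l ?(leq_trans Np) // ler1n ltnW.
have dU i : (diam_pow s (U i) <= (oapp g 0 (pickle_inv i))%:E)%E.
  rewrite /U; case: pickle_inv => [p|] /=; last by rewrite /diam_pow eqxx.
  rewrite /g; case: ifP => [/andP[Np pW]|_]; last by rewrite /diam_pow eqxx.
  rewrite /diam_pow; case: eqP => [_|/eqP/set0P[x wx]]; first by rewrite lee_fin powR_ge0.
  have := diam_word_cylinder p.2; have := diam_ge0 wx.
  rewrite (szW _ _ pW); case: diam => // d; rewrite !lee_fin => d0 dle.
  by rewrite ge0_ler_powR ?nnegrE ?(ltW s0) // invr_ge0 exprn_ge0.
apply: lime_le; first by apply: is_cvg_nneseries => i _ _; exact: diam_pow_ge0.
near=> M.
apply: (@le_trans _ _ (\sum_(0 <= i < M) (oapp g 0 (pickle_inv i))%:E)%E).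
  by apply: lee_sum => i _; exact: dU.
rewrite sumEFin lee_fin.
have -> : \sum_(0 <= i < M) oapp g 0 (pickle_inv i) =
    \sum_(p <- [seq p <- pmap (@pickle_inv _) (iota 0 M) | good p]) (b%:R ^+ l p.1)^-1 `^ s.
  rewrite [RHS]big_filter [RHS]big_mkcond [RHS]big_pmap /index_iota subn0.
  by apply: eq_bigr => i _; case: pickle_inv => [p|].
set ps := [seq _ <- _ | _].
pose K := (\max_(p <- ps) p.1).+1.
pose Q := [seq (n, w) | n <- iota N (K - N), w <- W n].
apply: (@le_trans _ _ (\sum_(p <- Q) (b%:R ^+ l p.1)^-1 `^ s)).
  apply: ler_sum_sub => [p||p pps]; first exact: powR_ge0.
    by apply/filter_uniq/(pmap_uniq (@pickle_invK _))/iota_uniq.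
  have pK : (p.1 < K)%N by rewrite ltnS; exact: leq_bigmax_seq pps isT.
  move: pps; rewrite mem_filter => /andP[/andP[Np pW] _].
  apply/allpairsPdep; exists p.1, p.2; split=> //; last by case: p {Np pW pK}.
  by rewrite mem_iota Np subnKC // (leq_trans Np) // ltnW.
rewrite big_allpairs_dep /= (le_trans _ Neta) //.
apply: (@le_trans _ _ (\sum_(n <- iota N (K - N)) C * r ^+ n)).
  apply: ler_sum => n _; apply: le_trans (smallW n).
  by rewrite big_const_seq count_predT iter_addr_0 mulr_natl.
by rewrite -mulr_sumr ler_wpM2l // geometric_sum_le.
Unshelve. all: by end_near. Qed.

End Covering.

(** * Upper and lower bounds *)

Definition letter (b : nat) (A : {set 'I_b}) : finType := {x : 'I_b | x \in A}.

Definition letter_val (b : nat) (A : {set 'I_b}) : letter A -> 'I_b := val.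

Lemma letter_val_inj (b : nat) (A : {set 'I_b}) : injective (@letter_val b A).
Proof. exact: val_inj. Qed.

Section DigitWords.
Variables (R : realType) (b : nat) (A : {set 'I_b}).
Hypothesis b_gt1 : (1 < b)%N.
Hypothesis A_gt1 : (1 < #|A|)%N.
Local Notation k := #|A|.
Local Notation B := (letter A).
Local Notation letters := (map (@letter_val b A)).

Lemma card_letters : #|B| = k.
Proof. by rewrite card_sig. Qed.

Lemma digits_lift (omega : nat -> 'I_b) : (forall i, omega i \in A) ->
  exists omega' : nat -> B, forall i, omega i = letter_val (omega' i).
Proof. by move=> h; exists (fun i => Sub (omega i) (h i)). Qed.

Lemma letters_mkseq (omega : nat -> 'I_b) (omega' : nat -> B) n :
  (forall i, omega i = letter_val (omega' i)) -> mkseq omega n = letters (mkseq omega' n).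
Proof. by move=> h; rewrite /mkseq -map_comp; apply: eq_map => i; exact: h. Qed.

Lemma letters_inj : injective letters.
Proof. exact/inj_map/letter_val_inj. Qed.

Lemma inv_pow_powR (s : R) n : (b%:R ^+ n)^-1 `^ s = (b%:R `^ s)^-1 ^+ n.
Proof.
have b0 : 0 <= b%:R :> R by [].
by rewrite -powR_mulrn // -powRN -powRrM mulNr [n%:R * s]mulrC -mulNr powRrM
  powRN powR_mulrn ?invr_ge0 ?powR_ge0.
Qed.

Lemma ln_base_gt0 : 0 < ln b%:R :> R.
Proof. by rewrite ln_gt0 // ltr1n. Qed.

Lemma lt_base_powR (s y : R) : 0 < y -> ln y / ln b%:R < s -> y < b%:R `^ s.
Proof.
move=> y0; rewrite ltr_pdivrMr ?ln_base_gt0 // => h.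
by rewrite /powR gt_eqF ?ltr0n ?(ltnW b_gt1) // -ltr_ln ?posrE ?expR_gt0 // expRK.
Qed.

Lemma digit_set_dim_le : (hausdorff_dim (digit_set R A) <= (ln k%:R / ln b%:R)%:E)%E.
Proof.
have k0 : 0 < k%:R :> R by rewrite ltr0n ltnW.
apply: hausdorff_dim_le => [|s ks].
  by rewrite divr_ge0 ?ln_ge0 ?ler1n ?(ltnW A_gt1) ?(ltnW b_gt1).
have kb := lt_base_powR k0 ks.
have s0 : 0 < s by apply: le_lt_trans ks; rewrite divr_ge0 ?ln_ge0 ?ler1n ?(ltnW A_gt1) ?(ltnW b_gt1).
have bs0 : 0 < b%:R `^ s by exact: lt_trans kb.
pose W n := [seq letters t | t : n.-tuple B].
apply: (@hausdorff_measure_cover0 _ _ b_gt1 _ s 1 (k%:R / b%:R `^ s) id W) => //.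
- by rewrite ltr_pdivrMr // mul1r.
- by move=> n w /mapP[t _ ->]; rewrite size_map size_tuple.
- move=> n; rewrite size_map -cardE card_tuple card_letters inv_pow_powR mul1r.
  by rewrite natrX -exprMn.
move=> N x [_ [omega oA ex]]; exists N => //; exists omega => //.
have [omega' oE] := digits_lift oA; rewrite (letters_mkseq _ oE).
have -> : mkseq omega' N = val [tuple omega' j | j < N].
  by rewrite /mkseq -val_enum_ord -map_comp.
by apply: map_f; rewrite mem_enum.
Qed.

Definition eulerian_words n : seq (seq 'I_b) :=
  if n is M.+2 then
    [seq letters (val p.1 ++ val p.2) |
     p in [set p : M.+1.-tuple B * (k ^ M.+2).-tuple B |
       uniq (trace (@dbstep _ M) p.1 p.2) & (k ^ M.+2 == #|{: M.+1.-tuple B}| * #|B|)%N]]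
  else [::].

Lemma size_eulerian_words n : (0 < n)%N ->
  (size (eulerian_words n) <= k ^ n.-1 * k`! ^ (k ^ n.-1))%N.
Proof.
case: n => [|[|M]] // _; rewrite size_map -cardE.
apply: leq_trans (card_eulerian_walks _ _) _.
by rewrite card_tuple card_letters.
Qed.

Lemma de_bruijn_factor_inj n (s : seq 'I_b) : de_bruijn A n s ->
  forall i j, (i + n <= size s)%N -> (j + n <= size s)%N ->
    take n (drop i s) = take n (drop j s) -> i = j.
Proof.
move=> [_ sA all_n] i j si sj e.
have sz : size (take n (drop i s)) = n by rewrite size_takel // size_drop; lia.
have [|i0 [_ uniq_i]] := all_n _ sz.
  by move=> x /mem_take/mem_drop; exact: sA.
by rewrite -(uniq_i i) // -(uniq_i j).
Qed.

Lemma de_bruijn_eulerian n (omega : nat -> 'I_b) : (1 < n)%N ->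
  (forall i, omega i \in A) -> de_bruijn_orders A omega n ->
  mkseq omega (de_bruijn_length k n) \in eulerian_words n.
Proof.
case: n => [|[|M]] // _ oA [_ dB]; have [omega' oE] := digits_lift oA.
have lE : de_bruijn_length k M.+2 = (M.+1 + k ^ M.+2)%N by rewrite /de_bruijn_length; lia.
move: dB; rewrite lE (letters_mkseq _ oE) => /de_bruijn_factor_inj inj.
pose a := [tuple omega' j | j < M.+1].
pose u := [tuple omega' (M.+1 + j)%N | j < k ^ M.+2].
have aE : val a = mkseq omega' M.+1 by rewrite /mkseq -val_enum_ord -map_comp.
have uE : val u = mkseq (fun j => omega' (M.+1 + j)%N) (k ^ M.+2).
  by rewrite /mkseq -val_enum_ord -map_comp.
have auE : mkseq omega' (M.+1 + k ^ M.+2) = val a ++ val u by rewrite aE uE mkseqD.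
rewrite auE; apply: (map_f (fun p => letters (val p.1 ++ val p.2)) (x := (a, u))).
rewrite mem_enum inE /= card_tuple card_letters -expnSr eqxx andbT.
apply: (@map_uniq _ _ (fun e => rcons (val e.1) e.2)).
rewrite trace_factors map_inj_in_uniq ?iota_uniq // => i j.
rewrite !mem_iota /= !add0n size_tuple !card_ord => ik jk e.
have lt_size h : (h < k ^ M.+2)%N -> (h + M.+2 <= M.+1 + k ^ M.+2)%N.
  by rewrite addnS -addSn addnC leq_add2l.
apply: inj; rewrite ?size_map ?size_iota; [exact: lt_size|exact: lt_size|].
have fE h : letters (factor M.+2 (val a ++ val u) h) =
    take M.+2 (drop h (letters (mkseq omega' (M.+1 + k ^ M.+2)))).
  by rewrite -auE /factor map_take map_drop.
exact: etrans (esym (fE i)) (etrans (congr1 letters e) (fE j)).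
Qed.

Lemma bernoulli_ge (x : R) v : 0 <= x -> v%:R * x <= (1 + x) ^+ v.
Proof.
move=> x0; elim: v => [|v IH]; first by rewrite mul0r.
have p1 : 1 <= (1 + x) ^+ v by rewrite exprn_ege1 // lerDl.
by rewrite exprSr mulrDr mulr1 -natr1 mulrDl mul1r lerD // ler_peMl.
Qed.

(** Bernoulli for the square root: if [rho = (1 + x) ^ 2], then [v x <= (1 + x) ^ v], whence
    [(v x) ^ 2 <= rho ^ v]. *)
Lemma linear_le_exp (rho : R) : 1 < rho -> exists2 C, 0 <= C &
  forall v, (0 < v)%N -> v%:R / rho ^+ v <= C / v%:R.
Proof.
move=> rho1; have rho0 : 0 <= rho by rewrite ltW // (lt_trans ltr01).
pose x := Num.sqrt rho - 1.
have x0 : 0 < x by rewrite subr_gt0 -sqrtr1 ltr_sqrt // (lt_trans ltr01).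
exists ((x ^+ 2)^-1) => [|v v0]; first by rewrite invr_ge0 sqr_ge0.
have vR : 0 < v%:R :> R by rewrite ltr0n.
have rE : rho = (1 + x) ^+ 2 by rewrite addrC subrK sqr_sqrtr.
have h := bernoulli_ge v (ltW x0).
rewrite ler_pdivrMr ?exprn_gt0 ?(lt_trans ltr01) // mulrAC ler_pdivlMr //.
rewrite [leRHS]mulrC ler_pdivlMr ?exprn_gt0 // -expr2 -exprMn rE -exprM mulnC exprM.
have x0le := ltW x0.
have p0 : 0 <= 1 + x := addr_ge0 ler01 x0le.
by apply: lerXn2r; rewrite ?nnegrE ?exprn_ge0 ?mulr_ge0.
Qed.

(** With [v = k ^ (n - 1)] there are at most [v * k!^v] words, of length at least [k v]. For [s]
    above the bound, [b ^ (s k)] exceeds [k!] by a factor [rho > 1], so order [n] weighs at most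
    [v / rho ^ v <= C / v], and [v >= 2 ^ (n - 1)]. *)
Lemma uniformly_de_bruijn_dim_le :
  (hausdorff_dim (uniformly_de_bruijn_set R A) <=
   (ln (k`!)%:R / (k%:R * ln b%:R))%:E)%E.
Proof.
have k0 : 0 < k%:R :> R by rewrite ltr0n ltnW.
have f0 : 0 < (k`!)%:R :> R by rewrite ltr0n fact_gt0.
have lf0 : 0 <= ln (k`!)%:R :> R by rewrite ln_ge0 // ler1n fact_gt0.
have lb := ln_base_gt0.
have d0 : 0 <= ln (k`!)%:R / (k%:R * ln b%:R) :> R by rewrite divr_ge0 // mulr_ge0 ?ltW.
apply: hausdorff_dim_le => // s ks.
have s0 : 0 < s by apply: le_lt_trans ks.
set beta := b%:R `^ s.
have beta1 : 1 <= beta by rewrite -(powRr0 b%:R) ler_powR ?ler1n ?(ltnW b_gt1) // ltW.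
have beta0 : 0 < beta by exact: lt_le_trans beta1.
have beta_k : (k`!)%:R < beta ^+ k.
  rewrite -powR_mulrn ?(ltW beta0) // -powRrM; apply: lt_base_powR => //.
  rewrite -ltr_pdivrMr // -mulrA -invfM [ln b%:R * _]mulrC; exact: ks.
pose rho := beta ^+ k / (k`!)%:R.
have rho1 : 1 < rho by rewrite ltr_pdivlMr // mul1r.
have [C C0 hC] := linear_le_exp rho1.
apply: (@hausdorff_measure_cover0 _ _ b_gt1 _ s (2 * C) 2^-1 (de_bruijn_length k) eulerian_words) => //.
- by rewrite mulr_ge0.
- by rewrite invf_lt1 // ltr1n.
- by move=> n; rewrite /de_bruijn_length -addnBAC ?leq_addl // expn_gt0 (ltnW A_gt1).
- case=> [|[|M]] // w /mapP[p _ ->].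
  by rewrite size_map size_cat !size_tuple /de_bruijn_length addnS subn1 addnC.
- move=> n; have [n2|n2] := ltnP n 2.
    by case: n n2 => [|[|]] // _; rewrite mul0r !mulr_ge0.
  have n0 : (0 < n)%N by exact: ltnW.
  set v := (k ^ n.-1)%N; have v0 : (0 < v)%N by rewrite expn_gt0 (ltnW A_gt1).
  have lE : de_bruijn_length k n = (k * v + n.-1)%N.
    by rewrite /v -expnS prednK // /de_bruijn_length -subn1 addnBA.
  apply: (@le_trans _ _ (v%:R / rho ^+ v)).
    rewrite inv_pow_powR -/beta lE exprD exprM.
    apply: (@le_trans _ _ ((v * k`! ^ v)%N%:R * ((beta^-1 ^+ k) ^+ v * 1))).
      apply: ler_pM => //; first by rewrite mulr_ge0 ?exprn_ge0 ?invr_ge0 ?ltW.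
        by rewrite ler_nat size_eulerian_words.
      rewrite ler_wpM2l ?exprn_ge0 ?invr_ge0 ?(ltW beta0) // exprn_ile1 ?invr_ge0 ?(ltW beta0) //.
      by rewrite invf_le1.
    rewrite mulr1 natrM natrX -mulrA -exprMn exprVn.
    by rewrite -[in leRHS]exprVn /rho invf_div.
  apply: le_trans (hC v v0) _; rewrite [2 * C]mulrC -mulrA ler_wpM2l //.
  have -> : 2 * 2^-1 ^+ n = (2 ^+ n.-1)^-1 :> R.
    by rewrite exprVn -[in LHS](prednK n0) exprS invfM mulrA mulfV ?mul1r.
  rewrite lef_pV2 ?posrE ?ltr0n ?exprn_gt0 // -natrX ler_nat leq_exp2r //.
  by rewrite -subn1 subn_gt0.
move=> N x [_ [omega [oA ex [L hL]]]].
have [n /andP[Nn _] on] := hL N.+2 isT.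
exists n; first by exact: ltnW (ltnW Nn).
by exists omega => //; apply: de_bruijn_eulerian => //; exact: leq_trans Nn.
Qed.

End DigitWords.

(** * Lower bounds from the mass of a rule *)

Section DimensionLowerBounds.
Variables (R : realType) (b : nat) (A : {set 'I_b}).
Hypothesis b_gt1 : (1 < b)%N.
Hypothesis A_gt1 : (1 < #|A|)%N.
Local Notation k := #|A|.
Local Notation B := (letter A).
Local Notation letters := (map (@letter_val b A)).

Lemma letter_valP (c : B) : letter_val c \in A.
Proof. exact: (valP (c : {x : 'I_b | x \in A})). Qed.

Lemma expansion_digit_set (omega : nat -> B) (x : R) :
  is_expansion (@letter_val b A \o omega) x -> digit_set R A x.
Proof.
move=> ex; split; last by exists (@letter_val b A \o omega) => // i; exact: letter_valP.
by have := expansion_bounds b_gt1 0 ex; rewrite expr0 /= mul0r divr1.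
Qed.

Lemma digit_set_dim_ge : ((ln k%:R / ln b%:R)%:E <= hausdorff_dim (digit_set R A))%E.
Proof.
have k0 : 0 < k%:R :> R by rewrite ltr0n ltnW.
have lb := ln_base_gt0 R b_gt1.
have lk : 0 < ln k%:R :> R by rewrite ln_gt0 // ltr1n.
apply: hausdorff_dim_ge => s s0 sd.
apply: (@mass_distribution _ _ b_gt1 B _ (@letter_val_inj b A) (fun w => (k%:R ^+ size w)^-1)
  _ (ln k%:R / ln b%:R) 1) => //.
- move=> w; under eq_bigr => c _ do rewrite size_rcons.
  rewrite sumr_const -[RHS]mulr_natl card_letters exprS invfM mulrA mulfV ?mul1r //.
  by rewrite gt_eqF.
- by rewrite expr0 invr1.
- by rewrite divr_gt0.
- move=> w; rewrite mul1r inv_pow_powR // (_ : b%:R `^ _ = k%:R) ?exprVn //.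
  by rewrite /powR gt_eqF ?ltr0n ?(ltnW b_gt1) // divfK ?gt_eqF // lnK.
- by move=> omega _ x; exact: expansion_digit_set.
- exact: ltW.
Qed.

(** There are [k ^ n] positions and [k ^ n] words of length [n], so injectivity gives
    surjectivity. *)
Lemma factor_inj_de_bruijn n (w : seq B) : (0 < n)%N ->
  size w = (k ^ n + n - 1)%N ->
  {in [pred j | j < k ^ n]%N &, injective (factor n w)} ->
  de_bruijn A n (letters w).
Proof.
move=> n0 sw inj.
have kn0 : (0 < k ^ n)%N by rewrite expn_gt0 (ltnW A_gt1).
have in_range i : (i + n <= size (letters w))%N = (i < k ^ n)%N.
  by rewrite size_map sw -addnBAC // leq_add2r -ltnS subn1 prednK.
split; first by rewrite size_map.
  by move=> x /mapP[c _ ->]; exact: letter_valP.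
move=> u su uA.
have [u' uu'] : exists u' : seq B, u = letters u'.
  elim: u {su} uA => [|c u IH] uA; first by exists [::].
  have [d du|u' ->] := IH; first by apply: uA; rewrite inE du orbT.
  by exists ((exist _ c (uA c (mem_head _ _)) : B) :: u').
have size_factor i : (i < k ^ n)%N -> size (factor n w i) = n.
  by rewrite -in_range size_map => h; rewrite size_takel // size_drop leq_subRL // (leq_trans _ h) // leq_addr.
have [c0 _] : exists c0 : B, true 
  by case: u' uu' => [|c u'] uu'; [move: n0; rewrite -su uu' | exists c].
pose F (i : 'I_(k ^ n)) : n.-tuple B := insubd [tuple of nseq n c0] (factor n w i).
have FE i : val (F i) = factor n w i by rewrite val_insubd size_factor // eqxx.
have F_inj : injective F.
  by move=> i j e; apply/val_inj/inj; rewrite ?inE //= -!FE e.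
have su' : size u' == n by rewrite -su uu' size_map.
have /codomP[i iE] : Tuple su' \in codom F.
  by apply: inj_card_onto F_inj _ _; rewrite card_tuple card_letters card_ord.
have u'E : u' = factor n w i by rewrite -FE -iE.
exists i; split.
  by rewrite in_range ltn_ord uu' u'E /factor map_take map_drop.
move=> j []; rewrite in_range => jk; rewrite uu' u'E -map_drop -map_take => /letters_inj e.
by apply: inj; rewrite ?inE.
Qed.

Section RuleMass.
Variables (c0 : B) (rule : seq B -> {set B}).
Hypothesis rule_n0 : forall w, rule w != finset.set0.

Definition rule_mass (w : seq B) : R := \prod_(i < size w)
  if nth c0 w i \in rule (take i w) then (#|rule (take i w)|%:R)^-1 else 0.

Lemma rule_mass_ge0 w : 0 <= rule_mass w.
Proof. by apply: prodr_ge0 => i _; case: ifP => // _; rewrite invr_ge0. Qed.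

Lemma rule_mass_rcons w c : rule_mass (rcons w c) =
  rule_mass w * if c \in rule w then (#|rule w|%:R)^-1 else 0.
Proof.
rewrite /rule_mass size_rcons big_ord_recr /= nth_rcons ltnn eqxx; congr (_ * _).
  apply: eq_bigr => i _.
  by rewrite nth_rcons ltn_ord -cats1 takel_cat // ltnW.
by rewrite -cats1 take_size_cat.
Qed.

Lemma rule_mass_split w : rule_mass w = \sum_c rule_mass (rcons w c).
Proof.
under eq_bigr => c _ do rewrite rule_mass_rcons.
rewrite -mulr_sumr -big_mkcond /= sumr_const -[_^-1 *+ _]mulr_natl mulfV ?mulr1 //.
by rewrite pnatr_eq0 cards_eq0.
Qed.

Lemma rule_mass_neq0 (omega : nat -> B) n : rule_mass (mkseq omega n) != 0 ->
  forall m, (m < n)%N -> omega m \in rule (mkseq omega m).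
Proof.
elim: n => // n IH; rewrite mkseqS rule_mass_rcons mulf_eq0 negb_or => /andP[/IH{}IH hn] m.
rewrite ltnS leq_eqVlt => /orP[/eqP ->|]; last exact: IH.
by move: hn; case: ifP; rewrite ?eqxx.
Qed.

Lemma rule_massE (omega : nat -> B) n :
  (forall m, (m < n)%N -> omega m \in rule (mkseq omega m)) ->
  rule_mass (mkseq omega n) =
  expR (- \sum_(0 <= j < n) ln #|rule (mkseq omega j)|%:R).
Proof.
elim: n => [|n IH] h; first by rewrite big_geq // oppr0 expR0 /rule_mass big_ord0.
rewrite mkseqS rule_mass_rcons (h n) // IH => [|m mn]; last by apply: h; exact: ltnW.
rewrite big_nat_recr //= opprD expRD; congr (_ * _).
by rewrite expRN lnK // posrE ltr0n card_gt0.
Qed.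

End RuleMass.

(** The mass of an admissible word is [exp] of minus its entropy, at most [expR K * b ^ (- s1 n)];
    every word of positive mass follows the rule, so its branch is de Bruijn at all positive
    multiples of 3. *)
Lemma uniformly_de_bruijn_dim_ge :
  ((entropy_rate R k / ln b%:R)%:E <=
   hausdorff_dim (uniformly_de_bruijn_set R A))%E.
Proof.
have lb := ln_base_gt0 R b_gt1.
have B_gt1 : (1 < #|B|)%N by rewrite card_letters.
have [c0 _] : exists c0 : B, true.
  by move: (ltnW B_gt1) => /card_gt0P[c _]; exists c.
have [C C0 tree] := phase_tree R B_gt1.
pose select_spec i (a : (3 * i).+2.-tuple B) (u0 : seq B)
    (tX : ((3 * i).+2.-tuple B -> B) * {set (3 * i).+2.-tuple B}) :=
  uniq [seq tailw e.1 | e <- trace (@dbstep B (3 * i).+1) a u0] ->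
  (size u0 <= #|B| ^ (3 * i))%N ->
  [/\ forall p, p != a -> (p, tX.1 p) \notin trace (@dbstep B (3 * i).+1) a u0,
      trap_free (@dbstep B (3 * i).+1) a tX.1 tX.2 &
      exists2 pen, penalty_bound a u0 tX.2 pen &
      \sum_v pen v <= phase_rate R #|B| *
        (phase_loss R #|B| * (#|B| ^ (3 * i))%N%:R + C)].
have ex i a u0 : exists tX, @select_spec i a u0 tX.
  have [[tu su]|none] := pselect (uniq [seq tailw e.1 | e <- trace (@dbstep B (3 * i).+1) a u0]
      /\ (size u0 <= #|B| ^ (3 * i))%N).
    have [t [X [pen [h1 h2 h3 h4]]]] := tree _ a u0 tu su.
    by exists (t, X) => _ _; split=> //; exists pen.
  by exists (fun=> c0, finset.set0) => tu su; case: none.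
have [select selectP] : exists select, forall i a u0, @select_spec i a u0 (select i a u0).
  by exists (fun i a u0 => projT1 (cid (ex i a u0))) => i a u0; exact: projT2.
pose ru := rule c0 select.
have run0 w : ru w != finset.set0 := rule_neq0 c0 select w.
apply: hausdorff_dim_ge => s s0 sd.
have sg : s * ln b%:R < entropy_rate R k by rewrite -ltr_pdivlMr.
pose eps := (entropy_rate R k - s * ln b%:R) / 2.
have eps0 : 0 < eps by rewrite divr_gt0 // subr_gt0.
have [K hK] := rule_entropy_lower c0 B_gt1 C0 selectP eps0.
rewrite card_letters -/ru in hK.
pose s1 := (entropy_rate R k - eps) / ln b%:R.
have ss1 : s < s1 by rewrite ltr_pdivlMr // /eps; lra.
have bs1 : b%:R `^ s1 = expR (entropy_rate R k - eps).
  by rewrite /powR gt_eqF ?ltr0n ?(ltnW b_gt1) // divfK ?gt_eqF.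
apply: (@mass_distribution _ _ b_gt1 B _ (@letter_val_inj b A) (rule_mass c0 ru)
  _ s1 (expR K)) => //.
- exact: rule_mass_ge0.
- exact: rule_mass_split.
- by rewrite /rule_mass big_ord0.
- exact: le_lt_trans ss1.
- move=> w; have wE : mkseq (nth c0 w) (size w) = w by exact: mkseq_nth.
  have [->|w0] := eqVneq (rule_mass c0 ru w) 0.
    by rewrite mulr_ge0 ?expR_ge0 ?powR_ge0.
  rewrite -[X in rule_mass _ _ X]wE in w0 *.
  have adm := rule_mass_neq0 w0.
  rewrite rule_massE // inv_pow_powR // bs1 -expRN -expRM_natr -expRD ler_expR.
  have := hK _ _ adm; rewrite mulNr; lra.
- move=> omega pos x exx; split; first exact: expansion_digit_set exx.
  exists (@letter_val b A \o omega); split=> // [i|]; first exact: letter_valP.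
  have adm n : forall m, (m < n)%N -> omega m \in ru (mkseq omega m).
    by apply: rule_mass_neq0; rewrite gt_eqF.
  (* The order [3 * i.+1] is the least multiple of 3 not below [m]. *)
  exists 3%N => m m0; pose i := ((m + 2) %/ 3).-1.
  have iE : (3 * i.+1 = (m + 2) %/ 3 * 3)%N.
    by rewrite mulnC prednK // divn_gt0 // addn2; lia.
  exists (3 * i.+1)%N.
    rewrite iE; have := divn_eq (m + 2) 3; have := ltn_pmod (m + 2) (isT : 0 < 3)%N; lia.
  split=> //.
  have lE : de_bruijn_length k (3 * i.+1) = phase_start B i.+1.
    by rewrite /phase_start card_letters.
  have lmap : mkseq (@letter_val b A \o omega) (de_bruijn_length k (3 * i.+1)) =
      letters (mkseq omega (de_bruijn_length k (3 * i.+1))) by rewrite (@letters_mkseq _ _ _ omega).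
  rewrite lmap; apply: factor_inj_de_bruijn => //; first by rewrite size_mkseq.
  rewrite lE.
  have un := phase_uniq_all B_gt1 selectP (adm (phase_start B i.+1)).
  have inj := next_phase_factors B_gt1 selectP (adm (phase_start B i.+1))
    (ltnW (phase_start_lt B_gt1 i)) (un i (ltnW (phase_start_lt B_gt1 i))) (leqnn _).
  by rewrite card_letters in inj.
- exact: ltW.
Qed.

End DimensionLowerBounds.

Lemma fact_lt_exp k : (1 < k)%N -> (k`! < k ^ k)%N.
Proof.
case: k => [|[|k]] // _; elim: k => // k IH.
rewrite factS expnS ltn_pmul2l // (leq_trans IH) //.
by rewrite leq_exp2r.
Qed.

Lemma alpha_gt0 (R : realType) (k : nat) : (1 < k)%N -> 0 < alpha R k.
Proof.
move=> k1; have l2 : 0 < ln 2 :> R by rewrite ln_gt0 // ltr1n.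
rewrite /alpha; case: eqP => [_|/eqP k2]; first by rewrite divr_gt0.
case: eqP => [_|/eqP k3].
  have l3 : ln 2 < ln 3 :> R by rewrite ltr_ln ?posrE // ltr_nat.
  have l4 : ln 4 = 2 * ln 2 :> R.
    have -> : 4 = 2 * 2 :> R by lra.
    by rewrite lnM ?posrE //; lra.
  rewrite invr_gt0 mulr_gt0 // subr_gt0 mulrA ltr_pdivlMr l4; lra.
rewrite divr_gt0 ?mulr_gt0 ?ln_gt0 ?ltr1n ?ltr0n ?(ltnW k1) //.
have : (2`! <= (k - 2)`!)%N by apply: leq_fact; lia.
exact: leq_trans.
Qed.

Theorem theorem2p1 (R : realType) (b : nat) (A : {set 'I_b})
    (hb : (2 <= b)%N) (hA : (2 <= #|A|)%N) :
  let k := #|A| in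
  let delta : \bar R := hausdorff_dim (digit_set R A) in
  let dimS : \bar R := hausdorff_dim (uniformly_de_bruijn_set R A) in
  let c : R := ln (k`!)%:R / (k%:R * ln k%:R) in
  [/\ delta = (ln k%:R / ln b%:R)%:E,
      [/\ (0 < (alpha R k)%:E * delta)%E,
          ((alpha R k)%:E * delta <= dimS)%E,
          (dimS <= c%:E * delta)%E &
          (c%:E * delta < delta)%E] &
      (0 < dimS)%E /\ (dimS < delta)%E].
Proof.
move=> k delta dimS c.
have deltaE : delta = (ln k%:R / ln b%:R)%:E.
  by apply/eqP; rewrite eq_le digit_set_dim_le // digit_set_dim_ge.
have lb : 0 < ln b%:R :> R by rewrite ln_gt0 // ltr1n.
have lk : 0 < ln k%:R :> R by rewrite ln_gt0 // ltr1n.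
have k0 : 0 < k%:R :> R by rewrite ltr0n ltnW.
have d0 : 0 < ln k%:R / ln b%:R :> R by rewrite divr_gt0.
have lower0 : (0 < (alpha R k)%:E * delta)%E.
  by rewrite deltaE -EFinM lte_fin mulr_gt0 // alpha_gt0.
have lower : ((alpha R k)%:E * delta <= dimS)%E.
  apply: le_trans (uniformly_de_bruijn_dim_ge R hb hA).
  rewrite deltaE -EFinM lee_fin mulrA ler_pM2r ?invr_gt0 //.
  exact: alpha_le_entropy_rate.
have upper : (dimS <= c%:E * delta)%E.
  apply: le_trans (uniformly_de_bruijn_dim_le R hb hA) _.
  rewrite deltaE -EFinM lee_fin /c le_eqVlt; apply/orP; left; apply/eqP.
  by rewrite -/k; field; rewrite !gt_eqF.
have strict : (c%:E * delta < delta)%E.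
  rewrite deltaE -EFinM lte_fin gtr_pMl // /c ltr_pdivrMr ?mulr_gt0 // mul1r.
  rewrite mulr_natl -lnXn // -natrX ltr_ln ?posrE ?ltr0n ?fact_gt0 ?expn_gt0 ?(ltnW hA) //.
  by rewrite ltr_nat fact_lt_exp.
split=> //; split; first exact: lt_le_trans lower0 lower.
exact: le_lt_trans upper strict.
Qed.
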